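(* Let $H$ be a division ring of finite dimension over its centre $h$ and let $\sigma\in\mathrm{Aut}(H)$. Let $\alpha:G\to\mathrm{Gal}(L/H)$ be a finite embedding problem over $H$ and let $\tau\in\mathrm{Aut}(L)$ extend $\sigma$ and satisfy $\langle\widetilde{\tau},\mathrm{Gal}(\ell/h)\rangle=\langle\widetilde{\tau}\rangle\times\mathrm{Gal}(\ell/h)$ (internal direct product of subgroups of $\mathrm{Aut}(\ell)$), where $\widetilde{\tau}$ is the restriction of $\tau$ to the centre $\ell$ of $L$. Let $\gamma:\mathrm{Gal}(L'/H)\to G$ be a weak solution to $\alpha$ and let $\tau'$ be an automorphism of $L'$ of finite order extending $\tau$ and satisfying $\langle\widetilde{\tau'},\mathrm{Gal}(\ell'/h)\rangle=\langle\widetilde{\tau'}\rangle\times\mathrm{Gal}(\ell'/h)$ (internal direct product of subgroups of $\mathrm{Aut}(\ell')$), where $\widetilde{\tau'}$ is the restriction of $\tau'$ to the centre $\ell'$ of $L'$. Then there exists a split finite embedding problem $\alpha':G'\to\mathrm{Gal}(L'/H)$ over $H$ satisfying the following two conditions: 1) $\ker(\alpha)\cong\ker(\alpha')$; 2) every $(\sigma,\tau')$-geometric solution $\mathrm{Gal}(E'/H(t,\sigma))\to G'$ to $\alpha'$ yields a $(\sigma,\tau)$-geometric solution $\mathrm{Gal}(E/H(t,\sigma))\to G$ to $\alpha$ with $E\subseteq E'$ (i.e. whenever such a solution to $\alpha'$ exists for $E'$, there is a $(\sigma,\tau)$-geometric solution $\mathrm{Gal}(E/H(t,\sigma))\to G$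 to $\alpha$ with $E\subseteq E'$).
   Context: A division ring is a nonzero (not necessarily commutative) ring in which every nonzero element is invertible. An extension $L/H$ of division rings means that $H$ is a subring of $L$. $\mathrm{Aut}(L/H)$ is the group of automorphisms of $L$ fixing $H$ pointwise. $L/H$ is Galois (in the sense of Artin) if every element of $L$ fixed by all of $\mathrm{Aut}(L/H)$ lies in $H$; then $\mathrm{Gal}(L/H)=\mathrm{Aut}(L/H)$. Let $H$ be a division ring finite-dimensional over its centre $h$. If $L/H$ is Galois with finite group, the centre $\ell$ of $L$ contains $h$ and $\ell/h$ is finite Galois. A finite embedding problem over $H$ is an epimorphism $\alpha:G\to\mathrm{Gal}(L/H)$ with $G$ a finite group and $L/H$ a Galois extension. It is split if there is an embedding $\alpha':\mathrm{Gal}(L/H)\to G$ with $\alpha\circ\alpha'=\mathrm{id}$. If $L/H$ and $F/H$ are Galois with finite groups and $L\subseteq F$, the restriction map $\mathrm{res}^{F/H}_{L/H}:\mathrm{Gal}(F/H)\to\mathrm{Gal}(L/H)$ is well defined. A weak solution to $\alpha$ is a monomorphism $\beta:\mathrm{Gal}(F/H)\to G$, where $F/H$ is Galois with $L\subseteq F$, such that $\alpha\circ\beta=\mathrm{res}^{F/H}_{L/H}$. A solution is a weak solution that is an isomorphism. For $\sigma\in\mathrm{Aut}(H)$, $H[t,\sigma]$ is the ring of polynomials $\sum a_it^i$ with coefficients in $H$, usual addition and multiplication determined by $ta=\sigma(a)t$ for $a\in H$; it is an Ore domain and $H(t,\sigma)$ is its division ring of fractions (of finite dimension over its centre if $\sigma$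 has finite order). Let $\tau$ be an automorphism of $L$ of finite order extending $\sigma$, with restriction $\widetilde{\tau}$ to the centre $\ell$ of $L$, such that $\langle\widetilde{\tau},\mathrm{Gal}(\ell/h)\rangle$ is the internal direct product of $\langle\widetilde{\tau}\rangle$ and $\mathrm{Gal}(\ell/h)$. Then $L(t,\tau)/H(t,\sigma)$ is Galois with finite group and the restriction map $\mathrm{res}^{L(t,\tau)/H(t,\sigma)}_{L/H}:\mathrm{Gal}(L(t,\tau)/H(t,\sigma))\to\mathrm{Gal}(L/H)$ is a well-defined isomorphism. A $(\sigma,\tau)$-geometric solution to $\alpha:G\to\mathrm{Gal}(L/H)$ is a solution $\mathrm{Gal}(E/H(t,\sigma))\to G$ to the finite embedding problem $(\mathrm{res}^{L(t,\tau)/H(t,\sigma)}_{L/H})^{-1}\circ\alpha:G\to\mathrm{Gal}(L(t,\tau)/H(t,\sigma))$ over $H(t,\sigma)$. *)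

(* Defs.v *)
From HB Require Import structures.
From mathcomp Require Import all_boot all_order all_algebra all_fingroup.
From mathcomp Require Import boolp classical_sets.

Set Implicit Arguments.
Unset Strict Implicit.
Unset Printing Implicit Defensive.

Import GRing.Theory.
Local Open Scope ring_scope.

HB.mixin Record UnitRing_isDivisionRing R of GRing.UnitRing R := {
  unitr_neq0 : forall x : R, x != 0 -> x \is a GRing.unit
}.

#[short(type="divisionRingType")]
HB.structure Definition DivisionRing :=
  {R of UnitRing_isDivisionRing R & GRing.UnitRing R}.

Section RingAutomorphisms.
Variable R : nzRingType.

Record ring_aut := RingAut {
  aut_fun :> R -> R;
  aut_subproof :
    [/\ zmod_morphism aut_fun, monoid_morphism aut_fun & bijective aut_fun]
}.

HB.instance Definition _ := gen_eqMixin ring_aut.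
HB.instance Definition _ := gen_choiceMixin ring_aut.

Lemma aut_is_zmod (s : ring_aut) : zmod_morphism s.
Proof. by case: (aut_subproof s). Qed.
Lemma aut_is_monoid (s : ring_aut) : monoid_morphism s.
Proof. by case: (aut_subproof s). Qed.
Lemma aut_bij (s : ring_aut) : bijective s.
Proof. by case: (aut_subproof s). Qed.

HB.instance Definition _ (s : ring_aut) :=
  GRing.isZmodMorphism.Build R R (aut_fun s) (aut_is_zmod s).
HB.instance Definition _ (s : ring_aut) :=
  GRing.isMonoidMorphism.Build R R (aut_fun s) (aut_is_monoid s).

Lemma autP (s t : ring_aut) : s =1 t -> s = t.
Proof.
case: s t => [f Hf] [g Hg] /= /funext efg; rewrite {}efg in Hf *.
by congr RingAut; apply: Prop_irrelevance.
Qed.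

Fact aut_one_subproof :
  [/\ zmod_morphism (idfun : R -> R), monoid_morphism (idfun : R -> R)
    & bijective (idfun : R -> R)].
Proof. by split=> //; exists idfun. Qed.
Definition aut_one := RingAut aut_one_subproof.

Fact aut_mul_subproof (s t : ring_aut) :
  [/\ zmod_morphism (s \o t), monoid_morphism (s \o t) & bijective (s \o t)].
Proof.
split; first by move=> x y /=; rewrite !rmorphB.
- by split=> [|x y] /=; rewrite ?rmorph1 ?rmorphM.
- exact: bij_comp (aut_bij s) (aut_bij t).
Qed.
Definition aut_mul s t := RingAut (aut_mul_subproof s t).


Fact aut_surj (s : ring_aut) (y : R) : exists x, s x = y.
Proof. by have [f _ fK] := aut_bij s; exists (f y). Qed.
Definition aut_inv_fun (s : ring_aut) (y : R) : R := sval (cid (aut_surj s y)).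

Fact aut_invK (s : ring_aut) : cancel (aut_inv_fun s) s.
Proof. by move=> y; rewrite /aut_inv_fun; case: cid. Qed.
Fact aut_funK (s : ring_aut) : cancel s (aut_inv_fun s).
Proof. by move=> x; apply: (bij_inj (aut_bij s)); rewrite aut_invK. Qed.

Fact aut_inv_subproof (s : ring_aut) :
  [/\ zmod_morphism (aut_inv_fun s), monoid_morphism (aut_inv_fun s)
    & bijective (aut_inv_fun s)].
Proof.
have inj := bij_inj (aut_bij s).
split; first by move=> x y; apply: inj; rewrite rmorphB /= !aut_invK.
- by split=> [|x y]; apply: inj; rewrite ?rmorph1 ?rmorphM /= !aut_invK.
- by exists s; [exact: aut_invK | exact: aut_funK].
Qed.
Definition aut_inv s := RingAut (aut_inv_subproof s).

Fact aut_mulA : associative aut_mul. Proof. by move=> s t u; apply/autP. Qed.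
Fact aut_mul1 : left_id aut_one aut_mul.
Proof. by move=> s; apply/autP. Qed.
Fact aut_mulr1 : right_id aut_one aut_mul.
Proof. by move=> s; apply/autP. Qed.
Fact aut_mulV : left_inverse aut_one aut_inv aut_mul.
Proof. by move=> s; apply: autP; exact: aut_funK. Qed.
Fact aut_mulrV : right_inverse aut_one aut_inv aut_mul.
Proof. by move=> s; apply: autP; exact: aut_invK. Qed.

HB.instance Definition _ :=
  isGroup.Build ring_aut aut_mulA aut_mul1 aut_mulr1 aut_mulV aut_mulrV.

Lemma autM (s t : ring_aut) x : (s * t)%g x = s (t x). Proof. by []. Qed.
Lemma aut1 x : (1%g : ring_aut) x = x. Proof. by []. Qed.

(** Automorphisms fixing a subset [A] pointwise *)
Definition fixator (A : set R) : {pred ring_aut} :=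
  fun s => `[< forall x, A x -> s x = x >].

Lemma fixatorP (A : set R) (s : ring_aut) :
  reflect (forall x, A x -> s x = x) (s \in fixator A).
Proof. exact: asboolP. Qed.

Fact fixator_group (A : set R) : group_closed (fixator A).
Proof.
split; first by apply/fixatorP.
move=> s t /fixatorP sA /fixatorP tA; apply/fixatorP => x Ax /=.
by rewrite -[in LHS](tA x Ax) aut_funK sA.
Qed.
End RingAutomorphisms.

Section Galois.
Variables (H L : nzRingType) (i : {rmorphism H -> L}).

(** [i : H -> L] plays the role of the inclusion of an extension [L/H]; ring
    morphisms between division rings are injective.  [gal i] is [Aut(L/H)]. *)
Record gal := Gal {
  gal_aut :> ring_aut L;
  gal_fix : gal_aut \in fixator (range i)
}.
HB.instance Definition _ := [isSub for gal_aut].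
HB.instance Definition _ := [Choice of gal by <:].
HB.instance Definition _ := SubChoice_isSubGroup.Build (ring_aut L)
  (fixator (range i)) gal (@fixator_group L (range i)).

Definition artin_galois : Prop :=
  forall x : L, (forall s : gal, s x = x) -> exists a : H, x = i a.
End Galois.

(** [psi] is the restriction to [L] of [phi], along the inclusion [j : L -> F] *)
Definition restricts (L F : nzRingType) (j : {rmorphism L -> F})
    (phi : ring_aut F) (psi : ring_aut L) : Prop :=
  forall x, phi (j x) = j (psi x).

Section Centre.
Variable R : nzRingType.

Definition centre : {pred R} := fun z => `[< forall x, z * x = x * z >].

Lemma centreP z : reflect (forall x, z * x = x * z) (z \in centre).
Proof. exact: asboolP. Qed.

Fact centre_subring : subring_closed centre.
Proof.
split; first by apply/centreP=> x; rewrite mul1r mulr1.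
- move=> y z /centreP yC /centreP zC; apply/centreP=> x.
  by rewrite mulrBl mulrBr yC zC.
- move=> y z /centreP yC /centreP zC; apply/centreP=> x.
  by rewrite -mulrA zC mulrA yC mulrA.
Qed.

Record centre_of := CentreOf { centre_val : R; _ : centre_val \in centre }.
HB.instance Definition _ := [isSub for centre_val].
HB.instance Definition _ := [Choice of centre_of by <:].
HB.instance Definition _ :=
  GRing.SubChoice_isSubNzRing.Build R centre centre_of centre_subring.

Definition finite_dim_over_centre : Prop :=
  exists (n : nat) (e : 'I_n -> R), forall x, exists c : 'I_n -> centre_of,
    x = \sum_(k < n) val (c k) * e k.

Fact centre_aut_stable (s : ring_aut R) z : z \in centre -> s z \in centre.
Proof.
move=> /centreP zC; apply/centreP=> x; have [y <-] := aut_surj s x.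
by rewrite -!rmorphM zC.
Qed.

Definition centre_aut_fun (s : ring_aut R) (z : centre_of) : centre_of :=
  Sub (s (val z)) (centre_aut_stable s (valP z)).

Fact centre_aut_subproof (s : ring_aut R) :
  [/\ zmod_morphism (centre_aut_fun s), monoid_morphism (centre_aut_fun s)
    & bijective (centre_aut_fun s)].
Proof.
split; first by move=> x y; apply: val_inj; rewrite /= !rmorphB.
- by split=> [|x y]; apply: val_inj; rewrite /= ?rmorph1 ?rmorphM.
- exists (centre_aut_fun (s^-1)%g) => z; apply: val_inj => /=.
  + exact: aut_funK.
  + exact: aut_invK.
Qed.

(** Restriction of an automorphism of [R] to the centre of [R] *)
Definition centre_aut (s : ring_aut R) : ring_aut centre_of :=
  RingAut (centre_aut_subproof s).

Lemma centre_autE s z : val (centre_aut s z) = s (val z). Proof. by []. Qed.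
End Centre.
Arguments centre R : clear implicits.

Section InternalDirectProduct.
Variable G : groupType.
Local Open Scope classical_set_scope.
Local Open Scope group_scope.

Definition is_subgroup (A : set G) : Prop :=
  [/\ A 1, forall x y, A x -> A y -> A (x * y) & forall x, A x -> A x^-1].

Definition gen_subgroup (A : set G) : set G := smallest is_subgroup A.

Definition is_normal (A C : set G) : Prop :=
  [/\ is_subgroup A, A `<=` C & forall x a, C x -> A a -> A (a ^ x)].

Definition internal_dprod (C A B : set G) : Prop :=
  [/\ is_subgroup C, is_normal A C, is_normal B C, A `&` B = [set 1]
    & C = [set a * b | a in A & b in B]].
End InternalDirectProduct.

Section DirectProductCondition.
Variables (H L : nzRingType) (i : {rmorphism H -> L}).
Local Open Scope classical_set_scope.

(** [Gal(l/h)], where [l] and [h] are the centres of [L] and [H] *)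
Definition gal_centre : set (ring_aut (centre_of L)) :=
  [set` fixator [set z | exists2 a, a \in centre H & val z = i a]].

Definition centre_dprod (tau : ring_aut L) : Prop :=
  let cyc := gen_subgroup [set centre_aut tau] in
  internal_dprod (gen_subgroup (cyc `|` gal_centre)) cyc gal_centre.
End DirectProductCondition.

Section EmbeddingProblems.
Variables (G : finGroupType) (H L : divisionRingType) (i : {rmorphism H -> L}).
Variable alpha : {multiplicative G -> gal i}.

Definition finite_embedding_problem : Prop :=
  artin_galois i /\ forall s : gal i, exists g, alpha g = s.

Definition split_problem : Prop :=
  exists2 alpha' : {multiplicative gal i -> G},
    injective alpha' & forall s, alpha (alpha' s) = s.

Definition hom_ker : {set G} := [set g | alpha g == 1%g]%SET.

Section Solutions.
(** [F/H] with inclusion [iF], containing [L/H] through [j : L -> F] *)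
Variables (F : divisionRingType) (iF : {rmorphism H -> F}).
Variables (j : {rmorphism L -> F}) (beta : {multiplicative gal iF -> G}).

Definition weak_solution : Prop :=
  [/\ forall a, j (i a) = iF a, artin_galois iF, injective beta
    & forall s : gal iF, restricts j s (alpha (beta s))].

Definition solution : Prop := weak_solution /\ bijective beta.
End Solutions.
End EmbeddingProblems.

(** [R[t,s]]: the polynomial [p] stands for [\sum_k p`_k t^k], with
    coefficients on the left. *)
Definition skew_poly (R : nzRingType) (s : ring_aut R) : Type := {poly R}.

Section SkewPolynomials.
Variables (R : nzRingType) (s : ring_aut R).
Local Notation skew_poly := (skew_poly s).

HB.instance Definition _ := GRing.Zmodule.copy skew_poly {poly R}.

Definition skew_mul (p q : skew_poly) : skew_poly :=
  \poly_(n < (size p + size q).-1)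
    \sum_(k < n.+1) p`_k * (s ^+ k)%g (q`_(n - k)).

Implicit Types p q r : skew_poly.

Lemma coef_skew_mul p q n :
  (skew_mul p q)`_n = \sum_(k < n.+1) p`_k * (s ^+ k)%g q`_(n - k).
Proof.
rewrite coef_poly ltn_predRL; case: leqP => // le_pq_i1.
rewrite big1 // => j _; have [lq_p_j|lt_j_p] := leqP (size p) j.
  by rewrite nth_default ?mul0r.
rewrite [q`__]nth_default ?rmorph0 ?mulr0 // leq_subRL -ltnS //.
by rewrite (leq_trans _ le_pq_i1) // ltn_add2r.
Qed.

Lemma coef_skew_mul_rev p q n : (skew_mul p q)`_n =
  \sum_(k < n.+1) p`_(n - k) * (s ^+ (n - k))%g q`_k.
Proof.
rewrite coef_skew_mul (reindex_inj rev_ord_inj) /=.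
by apply: eq_bigr => j _; rewrite (sub_ordK j).
Qed.

Lemma autXD m n x : (s ^+ m)%g ((s ^+ n)%g x) = (s ^+ (m + n))%g x.
Proof. by rewrite expgnDr. Qed.

Fact skew_mulA : associative skew_mul.
Proof.
move=> p q r; apply/polyP=> i; rewrite coef_skew_mul coef_skew_mul_rev.
pose coef3 j k :=
  p`_j * ((s ^+ j)%g q`_(i - j - k) * (s ^+ (i - k))%g r`_k).
transitivity (\sum_(j < i.+1) \sum_(k < i.+1 | (k <= i - j)%N) coef3 j k).
  apply: eq_bigr => /= j _; rewrite coef_skew_mul_rev raddf_sum big_distrr /=.
  rewrite (big_ord_narrow_leq (leq_subr _ _)); apply: eq_bigr => k _ /=.
  rewrite rmorphM /= autXD /coef3; congr (_ * (_ * (s ^+ _)%g _)).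
  have le_k : (k <= i - j)%N by rewrite -ltnS.
  have le_j : (j <= i)%N by rewrite -ltnS.
  rewrite subnAC subnKC // leq_subRL 1?addnC -?leq_subRL //.
  exact: leq_trans le_k (leq_subr _ _).
rewrite (exchange_big_dep predT) //=; apply: eq_bigr => k _.
transitivity (\sum_(j < i.+1 | (j <= i - k)%N) coef3 j k).
  apply: eq_bigl => j; rewrite -ltnS -(ltnS j) -!subSn ?leq_ord //.
  by rewrite -subn_gt0 -(subn_gt0 j) -!subnDA addnC.
rewrite (big_ord_narrow_leq (leq_subr _ _)) coef_skew_mul big_distrl /=.
by apply: eq_bigr => j _; rewrite /coef3 -!subnDA addnC mulrA.
Qed.

Fact skew_mul1l : left_id (1%:P : skew_poly) skew_mul.
Proof.
move=> p; apply/polyP=> n; rewrite coef_skew_mul big_ord_recl subn0 big1.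
  by rewrite coefC eqxx mul1r addr0.
by move=> k _; rewrite coefC mul0r.
Qed.

Fact skew_mul1r : right_id (1%:P : skew_poly) skew_mul.
Proof.
move=> p; apply/polyP=> n; rewrite coef_skew_mul_rev big_ord_recl subn0 big1.
  by rewrite coefC eqxx rmorph1 mulr1 addr0.
by move=> k _; rewrite coefC rmorph0 mulr0.
Qed.

Fact skew_mulDl : left_distributive skew_mul +%R.
Proof.
move=> p q r; apply/polyP=> n; rewrite coefD !coef_skew_mul -big_split.
by apply: eq_bigr => k _; rewrite coefD mulrDl.
Qed.

Fact skew_mulDr : right_distributive skew_mul +%R.
Proof.
move=> p q r; apply/polyP=> n; rewrite coefD !coef_skew_mul -big_split.
by apply: eq_bigr => k _; rewrite coefD rmorphD mulrDr.
Qed.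

Fact skew_1_neq0 : (1%:P : skew_poly) != 0.
Proof. exact: poly1_neq0. Qed.

HB.instance Definition _ := GRing.Zmodule_isNzRing.Build skew_poly
  skew_mulA skew_mul1l skew_mul1r skew_mulDl skew_mulDr skew_1_neq0.

Definition skewC (a : R) : skew_poly := a%:P.
Definition skewX : skew_poly := 'X.

Fact skewC_is_zmod : zmod_morphism skewC.
Proof. by move=> a b; apply: polyCB. Qed.
Fact skewC_is_monoid : monoid_morphism skewC.
Proof.
split=> // a b; apply/polyP=> n; rewrite [RHS]coef_skew_mul big_ord_recl subn0.
rewrite big1 => [|k _]; last by rewrite !coefC /= mul0r.
by rewrite !coefC; case: n => [|n] /=; rewrite ?rmorph0 ?mulr0 addr0.
Qed.
HB.instance Definition _ :=
  GRing.isZmodMorphism.Build R skew_poly skewC skewC_is_zmod.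
HB.instance Definition _ :=
  GRing.isMonoidMorphism.Build R skew_poly skewC skewC_is_monoid.

Lemma coef_skewCM a p n : (skewC a * p)`_n = a * p`_n.
Proof.
rewrite [LHS]coef_skew_mul big_ord_recl subn0 coefC /= big1 ?addr0 // => k _.
by rewrite coefC /= mul0r.
Qed.

Lemma coef_skewXM p n : (skewX * p)`_n = if n is m.+1 then s p`_m else 0.
Proof.
rewrite [LHS]coef_skew_mul /skewX; case: n => [|n].
  by rewrite big_ord1 coefX /= mul0r.
rewrite big_ord_recl coefX /= mul0r add0r big_ord_recl coefX /= mul1r expg1.
rewrite subn1 /= big1 ?addr0 // => k _.
by rewrite coefX /= mul0r.
Qed.

Lemma skewX_C a : skewX * skewC a = skewC (s a) * skewX.
Proof.
apply/polyP=> n; rewrite coef_skewXM coef_skewCM coefX.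
by case: n => [|[|n]]; rewrite ?coefC /= ?mulr1 ?mulr0 ?rmorph0.
Qed.

Lemma skewXn n : skewX ^+ n = ('X^n : {poly R}).
Proof.
elim: n => // n IHn; apply/polyP=> k; rewrite exprS coef_skewXM IHn.
by case: k => [|k]; rewrite !coefXn // eqSS rmorph_nat.
Qed.

Lemma skew_polyE p : p = \sum_(k < size p) skewC p`_k * skewX ^+ k.
Proof.
rewrite -[LHS]coefK poly_def; apply: eq_bigr => k _; apply/polyP=> n.
by rewrite coef_skewCM skewXn coefZ.
Qed.
End SkewPolynomials.
Arguments skewC {R} s a.

(** The inclusion [H[t,sigma] -> L[t,tau]] induced by [i : H -> L] *)
Definition skew_map (H L : nzRingType) (i : {rmorphism H -> L})
    (sigma : ring_aut H) (tau : ring_aut L) (p : skew_poly sigma) :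
  skew_poly tau := map_poly i p.

(** [K] is the division ring of (right) fractions of [R], embedded through [f].
    It is determined up to unique isomorphism; for [R = H[t,sigma]] with [sigma]
    an automorphism, left and right fractions coincide. *)
Definition division_ring_of_fractions (R : nzRingType) (K : divisionRingType)
    (f : {rmorphism R -> K}) : Prop :=
  injective f /\ forall x, exists p q, q != 0 /\ x = f p / f q.

Section GeometricSolutions.
Variables (G : finGroupType) (H L : divisionRingType) (i : {rmorphism H -> L}).
Variable alpha : {multiplicative G -> gal i}.
Variable tau : ring_aut L.
Variables (Ht Lt : divisionRingType) (it : {rmorphism Ht -> Lt}).
Variable fL : {rmorphism skew_poly tau -> Lt}.
Variables (E : divisionRingType) (iE : {rmorphism Ht -> E}).
Variables (jE : {rmorphism Lt -> E}) (beta : {multiplicative gal iE -> G}).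

(** To be used with [Ht = H(t,sigma)], [Lt = L(t,tau)] and [it] induced by [i].
    [alphat] is the composite of [alpha] with the inverse of the restriction map
    [Gal(Lt/Ht) -> Gal(L/H)]: the first clause says [res \o alphat = alpha]. *)
Definition geometric_solution : Prop :=
  exists alphat : {multiplicative G -> gal it},
    [/\ forall g, restricts (fL \o skewC tau) (alphat g) (alpha g),
        finite_embedding_problem alphat
      & solution alphat jE beta].
End GeometricSolutions.

(* Main.v *)
Require Import Defs.
From HB Require Import structures.
From mathcomp Require Import all_boot all_order all_algebra all_fingroup finfield.
From mathcomp Require Import boolp classical_sets cardinality.

Set Implicit Arguments.
Unset Strict Implicit.
Unset Printing Implicit Defensive.

Import GRing.Theory.
Local Open Scope ring_scope.

(** The group [G'] is the fibre product of [alpha] and [alpha \o gamma] over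
    [Gal(L/H)], with [alpha'] its second projection.  It is split by
    [s |-> (gamma s, s)], and its kernel [{(g, 1) | alpha g = 1}] is a copy of
    that of [alpha].  Given a geometric solution [Gal(E'/H(t)) -> G'], compose it
    with the first projection [G' -> G] and let [E] be the subring of [E'] fixed
    by the kernel [N] of the composite.  The elements of [N] map to pairs
    [(1, s)] where [s] is trivial on [L], so they fix [L(t)], hence
    [L(t) <= E]; and [Gal(E/H(t)) = Gal(E'/H(t))/N = G], as wanted.

    What this needs is Galois theory for division rings, for three facts: the
    first projection is onto, because [Gal(L'/H) -> Gal(L/H)] is; every
    automorphism of [L(t)/H(t)] is induced by one of [L/H]; and the Galois
    correspondence holds for [N].  All follow from one statement,
    [artin_maximal]: a finite group [B] of automorphisms of [K] contains every
    automorphism that fixes [K^B], provided that only central elements of [K]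
    commute with [K^B] (the extension is outer).  Artin's argument bounds the
    dimension of [K] over [K^B] by [#|B|], and Dedekind's argument shows that
    automorphisms which differ by no inner automorphism are linearly
    independent.

    It remains to see that the extensions at hand are outer.  If [K/k]
    has finitely many automorphisms, the inner ones among them leave two cases:
    the centraliser of [k] in [K] is central, or it is finite
    ([centralizer_central_or_finite]).  In the second case, for [L/H] the ring
    [L] itself is finite, hence commutative by Wedderburn's theorem
    ([outer_of_finite_dim]); for [E'/H(t)] the second case is impossible,
    since the powers of [t^n], where [sigma^n = 1], are central in [H(t)]
    ([skew_fraction_outer]).

    For [L(t)/H(t)] finiteness of the group is not known beforehand, and
    centralising elements are computed instead
    ([skew_fraction_centralizer]): such an element is a fraction whose numerator
    and denominator have coefficients [x] with [a x = x tau^k(a)] on [H] for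
    some integer [k], so conjugation by [x] composed with [tau^k] is an element
    of [Gal(L/H)] that restricts to [tau^k] on the centre of [L].  The direct
    product condition makes this restriction trivial, and an element of [Gal(L/H)] which is trivial on the centre of [L]
    is the identity, by an argument of Skolem-Noether type
    ([trivial_on_centre]). *)

(** * Linear systems over a division ring *)

Lemma divring_mulfV (K : divisionRingType) (x : K) : x != 0 -> x / x = 1.
Proof. by move=> /unitr_neq0/mulrV. Qed.

Lemma divring_mulVf (K : divisionRingType) (x : K) : x != 0 -> x^-1 * x = 1.
Proof. by move=> /unitr_neq0/mulVr. Qed.

Lemma divring_mulf_eq0 (K : divisionRingType) (x y : K) :
  (x * y == 0) = (x == 0) || (y == 0).
Proof.
have [->|x0] := eqVneq x 0; first by rewrite mul0r eqxx.
apply/eqP/eqP => [xy0|->]; last by rewrite mulr0.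
by rewrite -[y]mul1r -(divring_mulVf x0) -mulrA xy0 mulr0.
Qed.

Lemma divring_morph_inj (K : divisionRingType) (R : nzRingType)
  (f : {rmorphism K -> R}) : injective f.
Proof.
apply: raddf_inj => x fx0; apply/eqP; apply: contraT => x0.
have := rmorph1 f; rewrite -(divring_mulfV x0) rmorphM fx0 mul0r.
by move/eqP; rewrite eq_sym oner_eq0.
Qed.

(** Gaussian elimination.  The ring is only asked to have right inverses, so that
    the lemma also applies to the converse ring, where unknowns stand on the
    left, and to the centre of a division ring. *)
Lemma linear_system (R : nzRingType) (T : eqType) (J : finType)
    (a : T -> J -> R) (s : seq T) :
  (forall x : R, x != 0 -> exists y, x * y = 1) -> (size s < #|J|)%N ->
  exists2 c : J -> R, exists j, c j != 0 &
    forall t, t \in s -> \sum_j a t j * c j = 0.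
Proof.
move=> Rinv; rewrite -cardsT; move: [set: J]%SET => A ltsA.
suff [c [cN0 _ cP]] : exists c : J -> R, [/\ exists j, c j != 0,
    forall j, j \notin A -> c j = 0 &
    forall t, t \in s -> \sum_j a t j * c j = 0] by exists c.
elim: s A ltsA a => [|t s IHs] A /= ltsA a.
  have /card_gt0P[j jA] := ltsA; exists (fun k => (k == j)%:R).
  split=> [|k kA|//]; first by exists j; rewrite eqxx oner_neq0.
  by case: eqP kA => [->/negP|].
have [at0|] := pselect (forall j, j \in A -> a t j = 0).
  have [c [cN0 cA cP]] := IHs A (ltnW ltsA) a; exists c; split=> // u.
  rewrite inE => /predU1P[->|/cP//]; apply: big1 => j _.
  by have [/at0->|/cA->] := boolP (j \in A); rewrite ?mul0r ?mulr0.
move=> /existsNP[j /not_implyP[jA /eqP atj0]]; have [y ajy] := Rinv _ atj0.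
have ltsAj : (size s < #|A :\ j|)%N.
  by move: ltsA; rewrite (cardsD1 j) jA.
have [c [[k ck0] cA cP]] := IHs _ ltsAj (fun u l => a u l - a u j * y * a t l).
have cj : c j = 0 by apply: cA; rewrite !inE eqxx.
(* The value at the pivot column [j] is forced by the equation [t]. *)
pose z := - (y * \sum_l a t l * c l).
exists (fun l => if l == j then z else c l); split.
- exists k; suff /negPf-> : k != j by [].
  by apply: contraNneq ck0 => ->; rewrite cj.
- move=> l lA; case: eqP => [lj|_]; first by rewrite lj jA in lA.
  by apply: cA; rewrite !inE negb_and lA orbT.
have split_sum u : \sum_l a u l * (if l == j then z else c l) =
    a u j * z + \sum_l a u l * c l.
  rewrite (bigD1 j) //= eqxx; congr (_ + _); rewrite [RHS](bigD1 j) //= cj.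
  by rewrite mulr0 add0r; apply: eq_bigr => l /negPf->.
move=> u; rewrite inE split_sum => /predU1P[->|/cP].
  by rewrite /z mulrN mulrA ajy mul1r addNr.
under eq_bigr do rewrite mulrBl -!mulrA.
rewrite sumrB -!mulr_sumr => /eqP; rewrite subr_eq0 => /eqP->.
by rewrite /z mulrN addNr.
Qed.

(** The shortest relation trick of Artin and Dedekind: a relation [v] whose
    support lies inside that of [w] minus one point is shorter than the shortest
    one.  Only normalisation is asked of [W], so that it may be stable under
    scaling on either side. *)
Lemma minimal_support (R : nzRingType) (J : finType) (W : set (J -> R)) :
  (exists2 w, W w & exists j, w j != 0) ->
  (forall w j, W w -> w j != 0 ->
     exists2 w', W w' & w' j = 1 /\ forall k, w k = 0 -> w' k = 0) ->
  exists2 w, W w & exists2 j, w j = 1 & forall v, W v -> v j = 0 ->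
    (forall k, w k = 0 -> v k = 0) -> forall k, v k = 0.
Proof.
move=> [w0 Ww0 w0N0] Wnorm; pose supp (w : J -> R) := [set j | w j != 0]%SET.
pose P n := `[< exists2 w, W w & (exists j, w j != 0) /\ #|supp w| = n >].
have /ex_minnP[n /asboolP[w Ww [[j wj0] cardw]] minn] : exists n, P n.
  by exists #|supp w0|; apply/asboolP; exists w0.
have [w' Ww' [w'j w'0]] := Wnorm w j Ww wj0; exists w' => //; exists j => //.
move=> v Wv vj v0 k; apply/eqP; apply: contraT => vk0.
have /minn : P #|supp v| by apply/asboolP; exists v => //; split=> //; exists k.
rewrite -cardw leqNgt => /negP[]; apply: proper_card; apply/properP; split.
  by apply/fintype.subsetP => l; rewrite !inE; apply: contra => /eqP/w'0/v0->.
by exists j; rewrite inE ?vj ?eqxx.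
Qed.

(** * Finite groups of automorphisms *)

Definition fixed (K : nzRingType) (B : set (ring_aut K)) : set K :=
  [set x | forall b, B b -> b x = x]%classic.

(** The conjugate equations [\sum_j b (x j) * c j = 0] are fewer than the
    unknowns.  The group [B] permutes them, so applying [b] to a shortest
    normalised solution and subtracting gives a shorter one: the solution has
    coefficients in [K^B], and the equation for [b = 1] is the relation sought. *)
Lemma artin_dependence (K : divisionRingType) (B : set (ring_aut K))
    (s : seq (ring_aut K)) (J : finType) (x : J -> K) :
  is_subgroup B -> B = [set` s]%classic -> (size s < #|J|)%N ->
  exists2 c : J -> K, exists j, c j != 0 &
    (forall j, fixed B (c j)) /\ \sum_j x j * c j = 0.
Proof.
move=> [B1 BM BV] Bs ltsJ.
pose W : set (J -> K) := [set c | forall b, B b -> \sum_j b (x j) * c j = 0]%classic.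
have [||w Ww [j0 wj0 wmin]] := @minimal_support K J W.
- have Kinv (y : K) : y != 0 -> exists z, y * z = 1.
    by move=> /divring_mulfV y1; exists y^-1.
  have [c cN0 cP] := @linear_system K _ J (fun b j => (b : ring_aut K) (x j)) s Kinv ltsJ.
  by exists c => // b; rewrite Bs; apply: cP.
- move=> w j Ww wj0; exists (fun k => w k / w j); last first.
    by rewrite divring_mulfV //; split=> // k ->; rewrite mul0r.
  by move=> b /Ww wb0; under eq_bigr do rewrite mulrA; rewrite -mulr_suml wb0 mul0r.
exists w; first by exists j0; rewrite wj0 oner_neq0.
split=> [j b Bb|]; last exact: Ww B1.
apply/eqP; rewrite -subr_eq0; apply/eqP; move: j.
apply: (wmin (fun j => b (w j) - w j)) => [b' Bb'||k ->]; first last.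
- by rewrite rmorph0 subr0.
- by rewrite wj0 rmorph1 subrr.
under eq_bigr do rewrite mulrBr; rewrite sumrB (Ww b' Bb') subr0.
have := congr1 b (Ww (b^-1 * b')%g (BM _ _ (BV _ Bb) Bb')).
rewrite rmorph0 rmorph_sum => wb0; rewrite -[RHS]wb0; apply: eq_bigr => j _.
by rewrite rmorphM -[in LHS](mulKVg b b').
Qed.

(** An independent family of maximal length spans.  Closure of [S] under
    [- (x / y)] is what solving a relation for one vector uses. *)
Lemma independent_spanning (K : divisionRingType) (S : set K) (n : nat) :
  (forall x y, S x -> S y -> S (- (x / y))) ->
  (forall m (x : 'I_m -> K), (n < m)%N -> exists2 c : 'I_m -> K,
     exists j, c j != 0 & (forall j, S (c j)) /\ \sum_j x j * c j = 0) ->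
  exists m (e : 'I_m -> K),
    (forall c, (forall j, S (c j)) -> \sum_j e j * c j = 0 -> forall j, c j = 0)
    /\ (forall x, exists2 c, forall j, S (c j) & x = \sum_j e j * c j).
Proof.
move=> SD dep; pose indep m (e : 'I_m -> K) := forall c, (forall j, S (c j)) ->
  \sum_j e j * c j = 0 -> forall j, c j = 0.
pose P m := `[< exists e, @indep m e >].
have P0 : exists m, P m.
  by exists 0; apply/asboolP; exists (fun=> 0) => c _ _ [].
have bP m : P m -> (m <= n)%N.
  move=> /asboolP[e ie]; rewrite leqNgt; apply/negP => /(dep _ e).
  by move=> [c [j]] + [Sc c0]; rewrite (ie c) ?eqxx.
have [m /asboolP[e ie] maxm] := ex_maxnP P0 bP; exists m, e; split=> // x.
pose e' (k : 'I_m.+1) := if unlift ord0 k is Some j then e j else x.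
have : ~ indep _ e'.
  move=> ie'; suff /maxm : P m.+1 by rewrite ltnn.
  by apply/asboolP; exists e'.
move=> /existsNP[c /not_implyP[Sc /not_implyP[c0 /existsNP[k ck]]]].
move: c0; rewrite big_ord_recl {1}/e' unlift_none.
under eq_bigr do rewrite /e' liftK; move=> xc.
have c00 : c ord0 != 0.
  apply/eqP => c00; apply: ck; move: xc; rewrite c00 mulr0 add0r => /ie ic.
  by case: (unliftP ord0 k) => [j ->|-> //]; apply: ic.
exists (fun j => - (c (lift ord0 j) / c ord0)) => [j|]; first exact: SD.
under eq_bigr do rewrite mulrN mulrA.
rewrite sumrN -mulr_suml -mulNr; move/eqP: xc; rewrite addr_eq0 => /eqP <-.
by rewrite -mulrA divring_mulfV // mulr1.
Qed.

(** The twisted multiplications [T_j x = s_j x * e_j] are right [S]-linear, so more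
    of them than the [m] generators of [K] over [S] satisfy a left linear relation.
    In a shortest one, replacing [x] by [y * x] and subtracting [s_j0 y] times the
    relation kills the term [j0], hence all terms, which says that [A j]
    intertwines [s_j] with [s_j0].  This is Dedekind's independence argument, the
    multipliers [e] being there for the Skolem-Noether theorem. *)
Lemma intertwined_relation (K : divisionRingType) (S : set K) (m : nat)
    (f : 'I_m -> K) (J : finType) (s : J -> ring_aut K) (e : J -> K) :
  (forall x, exists2 c, forall k, S (c k) & x = \sum_k f k * c k) ->
  (forall j x z, S z -> s j (x * z) * e j = s j x * e j * z) ->
  (m < #|J|)%N ->
  exists A : J -> K, exists2 j0, A j0 = 1 &
    \sum_j A j * e j = 0 /\ forall j x, A j * s j x = s j0 x * A j.
Proof.
move=> fP sS ltmJ.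
pose W : set (J -> K) :=
  [set A | forall x, \sum_j A j * (s j x * e j) = 0]%classic.
have [||A WA [j0 Aj0 Amin]] := @minimal_support K J W.
- have Kinv (y : K^c) : y != 0 -> exists z, y * z = 1.
    by move=> /divring_mulVf y1; exists (y : K)^-1.
  have [|A AN0 AP] := @linear_system K^c _ J
    (fun k j => s j (f k) * e j) (enum 'I_m) Kinv; first by rewrite size_enum_ord.
  exists A => // x; have [c Sc ->] := fP x.
  under eq_bigr do rewrite rmorph_sum mulr_suml mulr_sumr.
  rewrite exchange_big big1 //= => k _.
  under eq_bigr do rewrite sS // mulrA.
  by rewrite -mulr_suml [X in X * _](AP k) ?mul0r // mem_enum.
- move=> w j Ww wj0; exists (fun k => (w j)^-1 * w k); last first.
    by rewrite divring_mulVf //; split=> // k ->; rewrite mulr0.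
  by move=> x; under eq_bigr do rewrite -mulrA; rewrite -mulr_sumr Ww mulr0.
exists A; exists j0 => //; split=> [|j x].
  by rewrite -[RHS](WA 1); apply: eq_bigr => j _; rewrite rmorph1 mul1r.
apply/eqP; rewrite -subr_eq0; apply/eqP; move: j.
apply: (Amin (fun j => A j * s j x - s j0 x * A j)) => [y||k ->]; first last.
- by rewrite mulr0 mul0r subrr.
- by rewrite Aj0 mulr1 mul1r subrr.
under eq_bigr do rewrite mulrBl -!mulrA.
rewrite sumrB -mulr_sumr WA mulr0 subr0 -[RHS](WA (x * y)).
by apply: eq_bigr => j _; rewrite rmorphM !mulrA.
Qed.

Lemma fixed_div (K : divisionRingType) (B : set (ring_aut K)) x y :
  fixed B x -> fixed B y -> fixed B (x / y).
Proof.
move=> Bx By b Bb; rewrite rmorphM /= (Bx b Bb); congr (_ * _).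
have [->|y0] := eqVneq y 0; first by rewrite invr0 rmorph0.
by rewrite rmorphV ?unitr_neq0 //= (By b Bb).
Qed.

Lemma fixed_spanning (K : divisionRingType) (B : set (ring_aut K))
    (s : seq (ring_aut K)) :
  is_subgroup B -> B = [set` s]%classic ->
  exists m (e : 'I_m -> K), (m <= size s)%N /\
    forall x, exists2 c, forall j, fixed B (c j) & x = \sum_j e j * c j.
Proof.
move=> Bgrp Bs; have [||m [e [ie se]]] :=
  @independent_spanning K (fixed B) (size s).
- by move=> x y Bx By b Bb; rewrite rmorphN /= (fixed_div Bx By Bb).
- by move=> m x ltsm; apply: (artin_dependence x Bgrp Bs); rewrite card_ord.
exists m, e; split=> //; rewrite leqNgt; apply/negP => ltsm.
have [|c [j]] := @artin_dependence _ _ _ 'I_m e Bgrp Bs; first by rewrite card_ord.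
by move=> cj0 [Bc /ie/(_ j) cj]; rewrite cj ?eqxx in cj0.
Qed.

(** With [s] outside [B] there would be more automorphisms than the dimension of
    [K] over [K^B].  In the resulting relation, intertwining coefficients
    commute with [K^B], hence are central, so that nonzero ones belong to equal
    automorphisms: a single term remains, which is absurd. *)
Lemma artin_maximal (K : divisionRingType) (B : set (ring_aut K))
    (s : ring_aut K) :
  is_subgroup B -> finite_set B ->
  (forall c, (forall x, fixed B x -> c * x = x * c) -> c \in centre K) ->
  (forall x, fixed B x -> s x = x) -> B s.
Proof.
move=> Bgrp /finite_seqP[l0 Bl0] outer sB; apply: contrapT => NBs.
pose l := undup l0; have Bl : B = [set` l]%classic.
  by rewrite Bl0; apply/seteqP; split=> b /=; rewrite mem_undup.
have [m [f [lem fP]]] := fixed_spanning Bgrp Bl.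
pose l1 := s :: l; pose t (j : 'I_(size l1)) := nth 1%g l1 j.
have tB j x : fixed B x -> t j x = x.
  move=> Bx; have := mem_nth 1%g (ltn_ord j); rewrite inE -/(t j).
  by case/predU1P => [->|tl]; [exact: sB | apply: Bx; rewrite Bl].
have [||A [j0 Aj0 [A0 Aint]]] := @intertwined_relation K (fixed B) m f
  'I_(size l1) t (fun=> 1) fP.
- by move=> j x z Bz; rewrite !mulr1 rmorphM /= (tB j z).
- by rewrite card_ord.
have AC j : A j \in centre K.
  by apply: outer => x Bx; have := Aint j x; rewrite !tB.
move: A0; rewrite (bigD1 j0) //= Aj0 mulr1 big1 ?addr0 => [/eqP|j jj0].
  by rewrite oner_eq0.
rewrite mulr1; apply/eqP; apply: contraNT jj0 => Aj.
have uniq_l1 : uniq l1.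
  by rewrite /= undup_uniq andbT; apply/negP => sl; apply: NBs; rewrite Bl.
rewrite -val_eqE -(nth_uniq 1%g _ _ uniq_l1) ?ltn_ord //; apply/eqP; apply: autP => x.
have /centreP/(_ (t j x)) := AC j; rewrite Aint.
by move=> /(congr1 ( *%R^~ (A j)^-1)); rewrite -!mulrA divring_mulfV // !mulr1 => ->.
Qed.

(** * Centralisers *)

Lemma centre_inv (K : divisionRingType) (z : K) :
  z \in centre K -> z^-1 \in centre K.
Proof.
move=> /centreP zC; have [->|z0] := eqVneq z 0; last first.
  apply/centreP => x; apply: (mulrI (unitr_neq0 _ z0)).
  by rewrite mulrA divring_mulfV // mul1r mulrA zC -mulrA divring_mulfV // mulr1.
by apply/centreP => x; rewrite invr0 mul0r mulr0.
Qed.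

Lemma conj_aut (K : divisionRingType) (c : K) : c != 0 ->
  exists s : ring_aut K, forall x, s x = c * x / c.
Proof.
move=> c0; have sP : [/\ zmod_morphism (fun x => c * x / c),
    monoid_morphism (fun x => c * x / c) & bijective (fun x => c * x / c)].
  split=> [x y||]; first by rewrite mulrBr mulrBl.
    split=> [|x y]; first by rewrite mulr1 divring_mulfV.
    by rewrite !mulrA -[_ / c * c]mulrA divring_mulVf // mulr1.
  exists (fun x => c^-1 * x * c) => x.
    by rewrite !mulrA divring_mulVf // mul1r -mulrA divring_mulVf // mulr1.
  by rewrite !mulrA divring_mulfV // mul1r -mulrA divring_mulfV // mulr1.
by exists (RingAut sP).
Qed.

Definition centralizer (K : nzRingType) (k : set K) : set K :=
  [set c | forall x, k x -> c * x = x * c]%classic.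

(** If [c] centralises [k] without being central, conjugation by [c + z] for [z]
    central gives pairwise distinct automorphisms, so the centre [Z] is finite;
    and a nonzero element of the centraliser is determined by the automorphism it
    induces and an element of [Z]. *)
Lemma centralizer_central_or_finite (K : divisionRingType) (k : set K) :
  finite_set [set s : ring_aut K | forall x, k x -> s x = x]%classic ->
  (forall c, centralizer k c -> c \in centre K) \/ finite_set (centralizer k).
Proof.
set B := [set s | _]%classic => finB; set C := centralizer k.
have [|/existsNP[c /not_implyP[Cc /negP cNZ]]] :=
  pselect (forall c, C c -> c \in centre K); [by left | right].
have [inn innE] : exists inn : K -> ring_aut K,
    forall d, d != 0 -> forall x, inn d x = d * x / d.
  suff /choice[f fE] : forall d : K, exists s : ring_aut K,
    d != 0 -> forall x, s x = d * x / d by exists f.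
  move=> d; have [->|/conj_aut[s sE]] := eqVneq d 0; last by exists s.
  by exists 1%g => /negP[].
have innB d : C d -> d != 0 -> B (inn d).
  by move=> Cd d0 x kx; rewrite innE // Cd // -mulrA divring_mulfV // mulr1.
have inn_eq d d' : d != 0 -> d' != 0 -> inn d = inn d' ->
    d'^-1 * d \in centre K.
  move=> d0 d'0 dd'; apply/centreP => x.
  have : inn d (x : K) = inn d' x by rewrite dd'.
  rewrite !innE // => /(congr1 (fun y => d'^-1 * y * d)).
  rewrite -!mulrA divring_mulVf // mulr1 => ->.
  by rewrite [d'^-1 * (d' * _)]mulrA divring_mulVf // mul1r.
pose Z := [set` centre K]%classic.
have caddN0 z : Z z -> c + z != 0.
  move=> Zz; apply: contraNneq cNZ => /eqP; rewrite addr_eq0 => /eqP->.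
  apply/centreP => x; have /centreP zC := Zz.
  by rewrite mulNr mulrN zC.
have finZ : finite_set Z.
  pose f z := inn (c + z).
  have finj : {in Z &, injective f}.
    move=> z z'; rewrite !inE => Zz Zz' /inn_eq-/(_ (caddN0 _ Zz) (caddN0 _ Zz')).
    set w := _ * _ => wZ.
    have cz : c + z = (c + z') * w.
      by rewrite mulrA divring_mulfV ?caddN0 // mul1r.
    have [w1|w1] := eqVneq w 1; first by apply: (addrI c); rewrite cz w1 mulr1.
    case/negP: cNZ; have w1' : 1 - w != 0 by rewrite subr_eq0 eq_sym.
    have -> : c = (z' * w - z) / (1 - w).
      apply: (mulIr (unitr_neq0 _ w1')); rewrite -mulrA divring_mulVf // mulr1.
      rewrite mulrBr mulr1; apply/eqP; rewrite subr_eq addrAC eq_sym subr_eq.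
      by rewrite cz mulrDl addrC.
    have [_ ZB ZM] := centre_subring K.
    apply: (ZM); first by apply: (ZB) => //; apply: ZM.
    by apply: centre_inv; apply: (ZB) => //; apply/centreP => x; rewrite mul1r mulr1.
  rewrite -(eq_finite_set (inj_card_eq finj)); apply: sub_finite_set finB.
  move=> _ [z Zz <-]; apply: innB (caddN0 _ Zz).
  by move=> x kx; have /centreP zC := Zz; rewrite mulrDl mulrDr Cc ?zC.
have [g gP] : exists g : ring_aut K -> K, forall d, C d -> d != 0 ->
    g (inn d) != 0 /\ inn (g (inn d)) = inn d.
  suff /choice[g gP] : forall b : ring_aut K, exists e : K, forall d, C d ->
      d != 0 -> inn d = b -> e != 0 /\ inn e = b.
    by exists g => d Cd d0; apply: (gP (inn d) d).
  move=> b; have [[d [Cd d0 db]]|nd] :=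
    pselect (exists d, [/\ C d, d != 0 & inn d = b]); first by exists d.
  by exists 0 => d Cd d0 db; case: nd; exists d.
have finU : finite_set (0 |` [set g b * z | b in B & z in Z])%classic.
  by rewrite finite_setU; split=> //; apply: finite_image2.
apply: sub_finite_set finU => d Cd; have [->|d0] := eqVneq d 0; first by left.
have [gd0 gdE] := gP d Cd d0.
right; exists (inn d); first exact: innB; exists ((g (inn d))^-1 * d).
  exact: inn_eq.
by rewrite mulrA divring_mulfV // mul1r.
Qed.

Lemma finite_spanning (K : nzRingType) (S : set K) (m : nat) (e : 'I_m -> K) :
  finite_set S ->
  (forall x, exists2 c, forall j, S (c j) & x = \sum_j e j * c j) ->
  finite_set [set: K].
Proof.
move=> /finite_seqP[s ->] eP.
pose f (g : {ffun 'I_m -> 'I_(size s)}) : K := \sum_j e j * nth 0 s (g j).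
have finT : finite_set [set: {ffun 'I_m -> 'I_(size s)}] := finite_finset.
apply: sub_finite_set (finite_image f finT) => x _.
have [c Sc ->] := eP x.
have cs j : (index (c j) s < size s)%N by rewrite index_mem; apply: Sc.
exists [ffun j => Ordinal (cs j)] => //.
by apply: eq_bigr => j _; rewrite ffunE nth_index //; apply: Sc.
Qed.

Lemma wedderburn (K : divisionRingType) :
  finite_set [set: K] -> commutative (@GRing.mul K).
Proof.
move=> /finite_seqP[s sP].
have Ks (x : K) : x \in s by have : [set: K]%classic x by []; rewrite sP.
have idxK : cancel (index^~ s) (nth (0 : K) s) by move=> x; apply: nth_index.
have finax : Finite.axiom (undup s).
  by move=> x; rewrite count_uniq_mem ?undup_uniq // mem_undup Ks.
pose R : finUnitRingType := HB.pack (K : Type)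
  (Choice_isCountable.Build K (can_pcan idxK)) (isFinite.Build K finax)
  (GRing.UnitRing.class K).
by apply: (@finDomain_mulrC R) => x y /eqP; rewrite divring_mulf_eq0.
Qed.

(** * Outer Galois extensions *)

Definition aut_over (H L : nzRingType) (i : {rmorphism H -> L}) :
  set (ring_aut L) := [set s | forall a, s (i a) = i a]%classic.

Lemma aut_over_subgroup (H L : nzRingType) (i : {rmorphism H -> L}) :
  is_subgroup (aut_over i).
Proof.
split=> // [s t Hs Ht a|s Hs a]; first by rewrite autM Ht Hs.
by rewrite -[in LHS]Hs; apply: aut_funK.
Qed.

Lemma galE (H L : nzRingType) (i : {rmorphism H -> L}) (s : gal i) a :
  s (i a) = i a.
Proof. by have /fixatorP sP := gal_fix s; apply: sP; exists a. Qed.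

Lemma gal_of_aut (H L : nzRingType) (i : {rmorphism H -> L}) (s : ring_aut L) :
  aut_over i s -> exists t : gal i, gal_aut t = s.
Proof.
move=> Hs; have sP : s \in fixator (range i) by apply/fixatorP => _ [a _ <-].
by exists (Gal sP).
Qed.

Lemma finite_aut_over (H L : nzRingType) (i : {rmorphism H -> L}) (T : finType)
    (f : T -> gal i) :
  (forall s, exists x, f x = s) -> finite_set (aut_over i).
Proof.
move=> fsurj; pose im := [set gal_aut (f x) | x in [set: T]]%classic.
have finim : finite_set im by apply: finite_image; apply: finite_finset.
apply: sub_finite_set finim => s /gal_of_aut[t <-].
by have [x <-] := fsurj t; exists x.
Qed.

Lemma gal_eqP (H L : nzRingType) (i : {rmorphism H -> L}) (s t : gal i) :
  (forall x, s x = t x) -> s = t.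
Proof. by move=> st; apply: val_inj; apply: autP. Qed.

Lemma artin_fixed (H L : nzRingType) (i : {rmorphism H -> L}) :
  artin_galois i -> fixed (aut_over i) = range i.
Proof.
move=> artin; apply/seteqP; split=> x; last by move=> [a _ <-] s; apply.
move=> xP; have [|a ->] := artin x; last by exists a.
by move=> s; apply: xP => a; apply: galE.
Qed.

(** [L] is finite over [H] and [H] over its centre; the scalars are kept in the
    centre of [H], which commutes with [H] and so ends up in the centre of [L]
    when [L/H] is outer. *)
Lemma spanning_over_centre (H L : divisionRingType) (i : {rmorphism H -> L}) :
  finite_dim_over_centre H -> artin_galois i -> finite_set (aut_over i) ->
  exists (J : finType) (e : J -> L), forall x,
    exists2 c : J -> centre_of H, True & x = \sum_j e j * i (val (c j)).
Proof.
move=> [n [e eP]] artin /finite_seqP[s sE].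
have [m [f [_ fP]]] := fixed_spanning (aut_over_subgroup i) sE.
exists ('I_m * 'I_n)%type, (fun p => f p.1 * i (e p.2)) => x.
have [a aH ->] := fP x.
have /choice[c cP] : forall k, exists c : 'I_n -> centre_of H,
    a k = \sum_l i (e l) * i (val (c l)).
  move=> k; have := aH k; rewrite artin_fixed // => -[b _ <-]; have [c ->] := eP b.
  exists c; rewrite rmorph_sum; apply: eq_bigr => l _; rewrite -rmorphM.
  by have /centreP-> := valP (c l).
exists (fun p => c p.1 p.2) => //.
rewrite -(pair_bigA _ (fun k l => f k * i (e l) * i (val (c k l)))) /=.
by apply: eq_bigr => k _; rewrite cP mulr_sumr; apply: eq_bigr => l _; rewrite mulrA.
Qed.

(** If the centraliser of [H] is finite, so are the centre of [H], which it
    contains, and [L], which is finite over that centre: Wedderburn's theorem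
    applies. *)
Lemma outer_of_finite_dim (H L : divisionRingType) (i : {rmorphism H -> L}) :
  finite_dim_over_centre H -> artin_galois i -> finite_set (aut_over i) ->
  forall c, centralizer (range i) c -> c \in centre L.
Proof.
move=> finH artin finG.
have [|//|finC c _] := @centralizer_central_or_finite L (range i).
  apply: sub_finite_set finG => s sP a; apply: sP; by exists a.
have [J [e eP]] := spanning_over_centre finH artin finG.
suff finL : finite_set [set: L] by apply/centreP => x; apply: wedderburn.
apply: (@finite_spanning L _ #|J| (e \o enum_val) finC) => x.
have [d _ ->] := eP x; exists (fun k => i (val (d (enum_val k)))).
  by move=> k _ [a _ <-]; rewrite -!rmorphM; have /centreP-> := valP (d (enum_val k)).
by rewrite (reindex (@enum_val J J)) //; apply: onW_bij; apply: enum_val_bij.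
Qed.

(** A Skolem-Noether argument.  If [L] has basis [e] of length [m] over its centre
    [Z], then [u] and the [m] multiplications [x |-> x * e_k] are [m.+1] maps
    which are linear over [Z], so they are related.  A shortest relation involves
    [u] and some multiplication, since [e] is independent over [Z]; its
    coefficients intertwine [u] and the identity, so they commute with [H], hence
    are central, and [u] is the identity. *)
Lemma trivial_on_centre (H L : divisionRingType) (i : {rmorphism H -> L})
    (u : ring_aut L) :
  finite_dim_over_centre H -> artin_galois i -> finite_set (aut_over i) ->
  aut_over i u -> (forall z, z \in centre L -> u z = z) -> u = 1%g.
Proof.
move=> finH artin finG uH uZ.
have outer := outer_of_finite_dim finH artin finG.
have [J [g gP]] := spanning_over_centre finH artin finG.
have iZ (a : centre_of H) : i (val a) \in centre L.
  apply: outer => _ [b _ <-]; rewrite -!rmorphM.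
  by have /centreP-> := valP a.
pose Z := [set` centre L]%classic.
have [||m [e [ie se]]] := @independent_spanning L Z #|J|.
- move=> x y Zx Zy; have [Z1 ZB ZM] := centre_subring L.
  rewrite -sub0r; apply: (ZB); first by rewrite -(subrr 1); apply: (ZB).
  by apply: ZM => //; apply: centre_inv.
- move=> q x ltJq; have [c cP] : exists c : 'I_q -> J -> centre_of H, forall k,
      x k = \sum_j g j * i (val (c k j)).
    suff /choice[c cP] : forall k, exists c : J -> centre_of H,
      x k = \sum_j g j * i (val (c j)) by exists c.
    by move=> k; have [c _ ?] := gP (x k); exists c.
  have [|| d [k dk0] dP] := @linear_system (centre_of L) _ 'I_q
    (fun j k => Sub (i (val (c k j))) (iZ (c k j))) (enum J).
  + move=> z z0; exists (Sub (val z)^-1 (centre_inv (valP z))).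
    by apply: val_inj => /=; rewrite divring_mulfV.
  + by rewrite card_ord -cardE.
  exists (fun k => val (d k)); first by exists k.
  split=> [l|]; first exact: valP.
  under eq_bigr do rewrite cP mulr_suml; rewrite exchange_big big1 //= => j _.
  under eq_bigr do rewrite -mulrA; rewrite -mulr_sumr.
  have /(congr1 val) := dP j (mem_enum _ _); rewrite raddf_sum /= => ->.
  by rewrite mulr0.
pose s (o : option 'I_m) := if o is Some _ then 1%g else u.
pose f (o : option 'I_m) := if o is Some k then e k else 1.
have [||A [j0 Aj0 [A0 Aint]]] := @intertwined_relation L Z m e _ s f se.
- move=> [k|] x z Zz /=; first by rewrite -!mulrA; have /centreP-> := Zz.
  by rewrite !mulr1 rmorphM /= (uZ z).
- by rewrite card_option card_ord.
have u_of c : c != 0 -> (forall x, c * x = u x * c) -> u = 1%g.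
  move=> c0 cu; have /centreP cZ : c \in centre L.
    by apply: outer => _ [a _ <-]; rewrite cu uH.
  by apply: autP => x; apply: (mulIr (unitr_neq0 _ c0)); rewrite -cu cZ.
case: j0 Aj0 Aint => [k0|] Aj0 Aint; last first.
  have [[k Ak]|Ak] := pselect (exists k, A (Some k) != 0).
    by apply: (u_of _ Ak) => x; rewrite (Aint (Some k)).
  move: A0; rewrite (bigD1 None) //= Aj0 mulr1 big1 ?addr0 => [/eqP|[k|//] _].
    by rewrite oner_eq0.
  have [->|Ak0] := eqVneq (A (Some k)) 0; first by rewrite mul0r.
  by case: Ak; exists k.
have [AN|AN] := eqVneq (A None) 0; last first.
  suff: (u^-1)%g = 1%g by move/(congr1 (fun s => s^-1)%g); rewrite invgK invg1.
  apply: autP => x; apply: (mulIr (unitr_neq0 _ AN)).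
  (* [A None] intertwines [u] and [1], which agree on [H]. *)
  have /centreP ANZ : A None \in centre L.
    by apply: outer => _ [a _ <-]; rewrite -[in LHS]uH (Aint None).
  have := Aint None ((u^-1)%g x); rewrite [s None _]aut_invK => <-.
  by rewrite ANZ.
have A00 : \sum_k e k * A (Some k) = 0.
  move: A0; rewrite (bigD1 None) //= AN mul0r add0r => A0; rewrite -[RHS]A0.
  rewrite (reindex_omap Some id) /=; last by case.
  apply: eq_big => [k|k _]; first by rewrite eqxx.
  have /centreP-> // : A (Some k) \in centre L.
  by apply: outer => _ [a _ <-]; have := Aint (Some k) (i a).
have AZ k : Z (A (Some k)).
  by apply: outer => _ [a _ <-]; have := Aint (Some k) (i a).
have /eqP := ie (fun k => A (Some k)) AZ A00 k0; rewrite Aj0.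
by rewrite oner_eq0.
Qed.

(** * Skew polynomials and their fractions *)

Lemma fraction_ind (R : nzRingType) (s : ring_aut R) (K : divisionRingType)
    (f : {rmorphism skew_poly s -> K}) (P : K -> Prop) :
  division_ring_of_fractions f ->
  (forall a, P (f (skewC s a))) -> P (f (skewX s)) ->
  (forall x y, P x -> P y -> P (x - y)) ->
  (forall x y, P x -> P y -> P (x * y)) ->
  (forall x, x != 0 -> P x -> P x^-1) -> forall x, P x.
Proof.
move=> [finj ffrac] PC PX PB PM PV x.
have P0 : P 0.
  by rewrite -(subrr (f (skewX s))); apply: PB.
have P1 : P 1.
  by rewrite -(rmorph1 f) -(rmorph1 (skewC s)); apply: PC.
have Pf p : P (f p).
  rewrite (skew_polyE p) rmorph_sum; apply: big_ind => // [y z Py Pz|k _].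
    by rewrite -[z]opprK; apply: (PB) => //; rewrite -sub0r; apply: PB.
  rewrite rmorphM rmorphXn; apply: (PM) => //.
  by elim: (k : nat) => [//|n IHn]; rewrite exprS; apply: PM.
have [p [q [q0 ->]]] := ffrac x; apply: (PM) => //; apply: PV => //.
by apply: contra_neq q0 => fq0; apply: finj; rewrite fq0 rmorph0.
Qed.

Lemma fraction_centreP (R : nzRingType) (s : ring_aut R) (K : divisionRingType)
    (f : {rmorphism skew_poly s -> K}) (c : K) :
  division_ring_of_fractions f ->
  (forall a, c * f (skewC s a) = f (skewC s a) * c) ->
  c * f (skewX s) = f (skewX s) * c -> c \in centre K.
Proof.
move=> ffrac cC cX; apply/centreP; apply: (fraction_ind ffrac) => //.
- by move=> x y cx cy; rewrite mulrBr mulrBl cx cy.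
- by move=> x y cx cy; rewrite mulrA cx -mulrA cy mulrA.
- move=> x x0 cx; apply: (mulrI (unitr_neq0 _ x0)).
  rewrite mulrA -cx -mulrA divring_mulfV // mulr1.
  by rewrite mulrA divring_mulfV // mul1r.
Qed.

Lemma coef_skewMC (R : nzRingType) (s : ring_aut R) (p : skew_poly s) a n :
  (p * skewC s a)`_n = p`_n * (s ^+ n)%g a.
Proof.
rewrite [LHS]coef_skew_mul_rev big_ord_recl subn0 coefC eqxx big1 ?addr0 //.
by move=> k _; rewrite coefC /= rmorph0 mulr0.
Qed.

Lemma centre_autM (R : nzRingType) (s t : ring_aut R) :
  centre_aut (s * t)%g = (centre_aut s * centre_aut t)%g.
Proof. by apply: autP => z; apply: val_inj. Qed.

Lemma gen_centre_aut (R : nzRingType) (s : ring_aut R) m n :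
  gen_subgroup [set centre_aut s]%classic (centre_aut (s ^+ m * (s ^+ n)^-1)%g).
Proof.
move=> A [[A1 AM AV] As].
have AX k : A (centre_aut (s ^+ k)%g).
  elim: k => [|k IHk]; last by rewrite expgS centre_autM; apply: AM => //; apply: As.
  by suff -> : centre_aut (s ^+ 0)%g = 1%g by []; apply: autP => z; apply: val_inj.
rewrite centre_autM; apply: AM => //.
suff -> : centre_aut (s ^+ n)^-1%g = ((centre_aut (s ^+ n))^-1)%g by apply: AV.
apply: (mulgI (centre_aut (s ^+ n)%g)); rewrite -centre_autM !mulgV.
by apply: autP => z; apply: val_inj.
Qed.

(** For [x != 0] the map sending [y] to [x * tau^(m - n)(y) / x] is an automorphism
    of [L/H].  On the centre of [L] it agrees with [tau^(m - n)], which therefore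
    belongs to [Gal(l/h)] as well as to the group generated by [tau], and is
    trivial; so the whole map is trivial. *)
Lemma twisted_commutation (H L : divisionRingType) (i : {rmorphism H -> L})
    (tau : ring_aut L) m n (x : L) :
  finite_dim_over_centre H -> artin_galois i -> finite_set (aut_over i) ->
  centre_dprod i tau ->
  (forall a, i a * x = x * (tau ^+ m * (tau ^+ n)^-1)%g (i a)) ->
  forall y, y * x = x * (tau ^+ m * (tau ^+ n)^-1)%g y.
Proof.
move=> finH artin finG [_ _ _ cap _] xH y; set th := (_ * _)%g in xH *.
have [->|x0] := eqVneq x 0; first by rewrite mulr0 mul0r.
have [inn innE] := conj_aut x0.
suff : (inn * th)%g = 1%g.
  move/(congr1 (fun s => aut_fun s y)); rewrite autM innE aut1 => {1}<-.
  by rewrite -mulrA divring_mulVf // mulr1.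
apply: (trivial_on_centre finH artin finG) => [a|z zZ].
  by rewrite autM innE -xH -mulrA divring_mulfV // mulr1.
rewrite autM innE; suff -> : th z = z.
  by have /centreP<- := zZ; rewrite -mulrA divring_mulfV // mulr1.
have : centre_aut th = 1%g.
  suff : [set 1%g]%classic (centre_aut th) by [].
  rewrite -cap; split; first exact: gen_centre_aut.
  rewrite /gal_centre /=; apply/fixatorP => w [a aZ wE]; apply: val_inj => /=.
  rewrite wE; apply: (mulrI (unitr_neq0 _ x0)); rewrite -xH -wE.
  by have /centreP-> := valP w.
by move/(congr1 (fun s => val (aut_fun s (Sub z zZ)))).
Qed.

(** Choose [r] monic of least degree [n] among the denominators of [c].  For [a]
    in [H] the polynomial [a r - r tau^(-n)(a)] has smaller degree and is again a
    denominator or zero, as [c] commutes with [a]; hence it vanishes.  So [r] and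
    [p = c r] satisfy the same commutation rule with [H], and
    [twisted_commutation], applied to each coefficient, extends it to [L]:
    [y] then passes through [r] and [p] in the same way, hence commutes with
    [c]. *)
Lemma skew_fraction_centralizer (H L : divisionRingType)
    (i : {rmorphism H -> L}) (tau : ring_aut L) (Lt : divisionRingType)
    (f : {rmorphism skew_poly tau -> Lt}) (c : Lt) :
  finite_dim_over_centre H -> artin_galois i -> finite_set (aut_over i) ->
  centre_dprod i tau -> division_ring_of_fractions f ->
  (forall a, c * f (skewC tau (i a)) = f (skewC tau (i a)) * c) ->
  forall y, c * f (skewC tau y) = f (skewC tau y) * c.
Proof.
move=> finH artin finG dprod [finj ffrac] cH y.
pose P n := `[< exists r p : skew_poly tau,
  [/\ r`_n = 1, forall k, (n < k)%N -> r`_k = 0 & c * f r = f p] >].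
have normalise (r p : skew_poly tau) :
    r != 0 -> c * f r = f p -> P (size (r : {poly L})).-1.
  move=> r0 crp; set n := (size _).-1.
  have rn0 : r`_n != 0 by rewrite -[r`_n]/(lead_coef (r : {poly L})) lead_coef_eq0.
  pose b := ((tau ^+ n)^-1)%g (r`_n)^-1.
  apply/asboolP; exists (r * skewC tau b), (p * skewC tau b); split.
  - by rewrite coef_skewMC -autM mulgV aut1 divring_mulfV.
  - move=> k ltnk; rewrite coef_skewMC nth_default ?mul0r //.
    by apply: leq_trans ltnk; apply: leqSpred.
  - by rewrite !rmorphM mulrA crp.
have [n /asboolP[r [p [rn rk crp]]] minn] : exists2 n, P n & forall m, P m -> (n <= m)%N.
  suff /ex_minnP[n] : exists n, P n by exists n.
  have [p [q [q0 cE]]] := ffrac c; exists (size (q : {poly L})).-1.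
  apply: (normalise q p) => //; rewrite cE -mulrA divring_mulVf ?mulr1 //.
  by apply: contra_neq q0 => fq0; apply: finj; rewrite fq0 rmorph0.
pose th k := (tau ^+ k * (tau ^+ n)^-1)%g.
have rH a k : i a * r`_k = r`_k * th k (i a).
  pose b := ((tau ^+ n)^-1)%g (i a).
  pose r1 : skew_poly tau := skewC tau (i a) * r - r * skewC tau b.
  suff /(congr1 (fun q : {poly L} => q`_k)) : r1 = 0.
    rewrite coef0 coefB coef_skewCM coef_skewMC => /eqP; rewrite subr_eq0.
    by move=> /eqP.
  apply/eqP; apply: contraT => r10.
  have r1k k' : (n <= k')%N -> r1`_k' = 0.
    rewrite coefB coef_skewCM coef_skewMC leq_eqVlt => /predU1P[<-|/rk->].
      by rewrite rn -autM mulgV aut1 mulr1 mul1r subrr.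
    by rewrite mulr0 mul0r subrr.
  have cr1 : c * f r1 = f (skewC tau (i a) * p - p * skewC tau b).
    by rewrite !rmorphB !rmorphM mulrBr !mulrA cH -crp -!mulrA crp !mulrA.
  have := minn _ (normalise _ _ r10 cr1); rewrite leqNgt => /negP[].
  have : r1`_(size (r1 : {poly L})).-1 != 0.
    by rewrite -[r1`__]/(lead_coef (r1 : {poly L})) lead_coef_eq0.
  by apply: contraNT; rewrite -leqNgt => /r1k->.
have comm (q : skew_poly tau) : (forall a k, i a * q`_k = q`_k * th k (i a)) ->
    skewC tau y * q = q * skewC tau (((tau ^+ n)^-1)%g y).
  move=> qH; apply/polyP => k; rewrite coef_skewCM coef_skewMC -autM.
  by apply: (twisted_commutation finH artin finG dprod) => a; apply: qH.
have pH a k : i a * p`_k = p`_k * th k (i a).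
  pose b := ((tau ^+ n)^-1)%g (i a).
  have rC : skewC tau (i a) * r = r * skewC tau b.
    by apply/polyP => l; rewrite coef_skewCM coef_skewMC rH.
  have pC : skewC tau (i a) * p = p * skewC tau b.
    by apply: finj; rewrite !rmorphM -crp mulrA -cH -!mulrA -!rmorphM rC.
  by have := congr1 (fun q : {poly L} => q`_k) pC; rewrite coef_skewCM coef_skewMC.
have fr0 : f r != 0.
  apply/eqP => fr0; have /eqP := rn; suff -> : r = 0 by rewrite coef0 eq_sym oner_eq0.
  by apply: finj; rewrite fr0 rmorph0.
apply: (mulIr (unitr_neq0 _ fr0)); rewrite -!mulrA crp -!rmorphM !comm //.
by rewrite !rmorphM mulrA crp.
Qed.

(** The powers of [t^n] are infinitely many central elements of [H(t)], which
    excludes the finite case of [centralizer_central_or_finite]. *)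
Lemma skew_fraction_outer (H : divisionRingType) (sigma : ring_aut H)
    (Ht : divisionRingType) (f : {rmorphism skew_poly sigma -> Ht})
    (E : divisionRingType) (iE : {rmorphism Ht -> E}) n :
  (0 < n)%N -> (sigma ^+ n)%g = 1%g -> division_ring_of_fractions f ->
  finite_set (aut_over iE) ->
  forall c, centralizer (range iE) c -> c \in centre E.
Proof.
move=> n0 sn ffrac finG.
have [|//|finC] := @centralizer_central_or_finite E (range iE).
  by apply: sub_finite_set finG => s sP a; apply: sP; exists a.
exfalso; apply: infinite_nat.
pose g k := iE (f (skewX sigma ^+ (n * k))).
have ginj : injective g.
  move=> k l /divring_morph_inj; have [finj _] := ffrac.
  move=> /finj/(congr1 (fun p : {poly H} => size p)).
  rewrite !skewXn !size_polyXn => -[] /eqP.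
  by rewrite eqn_pmul2l // => /eqP.
have /finite_preimage/(_ finC) : {in (g @^-1` centralizer (range iE))%classic &, injective g}.
  by move=> k l _ _; apply: ginj.
apply: sub_finite_set => k _ _ [x _ <-]; rewrite -!rmorphM; congr (iE _).
move: x; apply/centreP; apply: (fraction_centreP ffrac) => [a|].
  rewrite -!rmorphM; congr (f _); apply/polyP => l.
  rewrite skewXn coef_skewCM coef_skewMC coefXn.
  have [->|_] := eqVneq l (n * k)%N; last by rewrite mulr0 mul0r.
  by rewrite expgM sn expg1n mulr1 mul1r.
by rewrite -!rmorphM -exprS -exprSr.
Qed.

(** * Restriction of automorphisms *)

Lemma factor_through (A : nzRingType) (E F : divisionRingType)
    (e : {rmorphism E -> F}) (h : {rmorphism A -> F}) :
  (forall a, exists x, h a = e x) ->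
  exists h0 : {rmorphism A -> E}, forall a, e (h0 a) = h a.
Proof.
move=> /choice[k hk]; have einj := @divring_morph_inj _ _ e.
have kB : zmod_morphism k.
  by move=> a b; apply: einj; rewrite -hk !rmorphB !hk.
have kM : monoid_morphism k.
  by split=> [|a b]; apply: einj; rewrite -hk ?rmorph1 ?rmorphM ?hk.
pose m1 := GRing.isZmodMorphism.Build A E k kB.
pose m2 := GRing.isMonoidMorphism.Build A E k kM.
pose h0 : {rmorphism A -> E} := HB.pack k m1 m2.
by exists h0 => a; rewrite hk.
Qed.

(** Stability under both [s] and its inverse is asked because an injective
    endomorphism need not be onto when [F/E] is infinite. *)
Lemma restrict_aut (E F : divisionRingType) (e : {rmorphism E -> F})
    (s : ring_aut F) :
  (forall x, exists y, s (e x) = e y) ->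
  (forall x, exists y, (s^-1)%g (e x) = e y) ->
  exists t : ring_aut E, restricts e s t.
Proof.
move=> sE sVE; have einj := @divring_morph_inj _ _ e.
have [t tP] := @factor_through E E F e (s \o e) sE.
have [u uP] := @factor_through E E F e ((s^-1)%g \o e) sVE.
have tbij : bijective t.
  exists u => x; apply: einj.
    by rewrite uP /= tP /= -[RHS](aut_funK s).
  by rewrite tP /= uP /= -[RHS](aut_invK s).
have tA : [/\ zmod_morphism t, monoid_morphism t & bijective t].
  split=> //; first exact: rmorphB.
  by split; [exact: rmorph1 | exact: rmorphM].
by exists (RingAut tA) => x; rewrite [RHS]tP.
Qed.

Section RestrictionMaps.
Variables (H L F : divisionRingType).
Variables (i : {rmorphism H -> L}) (iF : {rmorphism H -> F}).
Variable j : {rmorphism L -> F}.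
Hypothesis jE : forall a, j (i a) = iF a.
Hypothesis artinF : artin_galois iF.
Hypothesis stable : forall s : gal iF, exists t : gal i, restricts j s t.

Lemma restricts_inj (s : ring_aut F) (t t' : ring_aut L) :
  restricts j s t -> restricts j s t' -> t = t'.
Proof.
by move=> st st'; apply: autP => x; apply: (@divring_morph_inj _ _ j); rewrite -st st'.
Qed.

Lemma restricts1 : restricts j (1%g : ring_aut F) (1%g : ring_aut L).
Proof. by []. Qed.

Lemma restrictsM (s s' : ring_aut F) (t t' : ring_aut L) :
  restricts j s t -> restricts j s' t' -> restricts j (s * s')%g (t * t')%g.
Proof. by move=> st st' x; rewrite autM st' st. Qed.

Lemma restrictsV (s : ring_aut F) (t : ring_aut L) :
  restricts j s t -> restricts j (s^-1)%g (t^-1)%g.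
Proof.
move=> st x; apply: (bij_inj (aut_bij s)).
by rewrite st [LHS]aut_invK [t _]aut_invK.
Qed.

Definition restrictions : set (ring_aut L) :=
  [set u | exists s : gal iF, restricts j s u]%classic.

Lemma restrictions_subgroup : is_subgroup restrictions.
Proof.
split=> [|u v [s su] [s' sv]|u [s su]]; first by exists 1%g; apply: restricts1.
  by exists (s * s')%g; apply: restrictsM.
by exists (s^-1)%g; apply: restrictsV.
Qed.

Lemma fixed_restrictions : (fixed restrictions `<=` range i)%classic.
Proof.
move=> x xP; have [|a jx] := artinF (x := j x); last first.
  by exists a => //; apply: (@divring_morph_inj _ _ j); rewrite jE.
by move=> s; have [t st] := stable s; rewrite st xP //; exists s.
Qed.

Lemma artin_galois_restriction : artin_galois i.
Proof.
move=> x xP; have [|a _ <-] := fixed_restrictions (t := x); last by exists a.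
move=> u [s su]; have [t st] := stable s.
by rewrite (restricts_inj su st) xP.
Qed.

(** The restrictions form a finite group of automorphisms of [L] with fixed ring
    [H], which [artin_maximal] shows to be all of [Gal(L/H)]. *)
Lemma restriction_surjective :
  finite_set (aut_over iF) ->
  (forall c, centralizer (range i) c -> c \in centre L) ->
  forall t : gal i, exists s : gal iF, restricts j s t.
Proof.
move=> finG outer t.
suff : restrictions t by [].
have fixB x : fixed restrictions x <-> range i x.
  split; first exact: fixed_restrictions.
  move=> [a _ <-] u [s su]; have [t' st'] := stable s.
  by rewrite (restricts_inj su st') galE.
apply: artin_maximal restrictions_subgroup _ _ _ => [|c cB|x /fixB[a _ <-]].
- have /choice[r rP] : forall s : ring_aut F, exists u : ring_aut L,
      aut_over iF s -> restricts j s u.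
    move=> s; have [/gal_of_aut[s' <-]|Ns] := pselect (aut_over iF s).
      by have [t' st'] := stable s'; exists t'.
    by exists 1%g.
  apply: sub_finite_set (finite_image r finG) => u [s su].
  have sH : aut_over iF s by move=> a; apply: galE.
  by exists s => //; apply: (restricts_inj (rP s sH) su).
- by apply: outer => x /fixB; apply: cB.
- exact: galE.
Qed.
End RestrictionMaps.

(** * The quotient of a Galois group by a normal subgroup *)

Section FixedRing.
Variables (K : divisionRingType) (B : set (ring_aut K)).

Definition fixed_pred : {pred K} := fun x => `[< fixed B x >].

Fact fixed_divring_closed : divring_closed fixed_pred.
Proof.
split; first by apply/asboolP => b _; rewrite rmorph1.
  move=> x y /asboolP Bx /asboolP By; apply/asboolP => b Bb.
  by rewrite rmorphB /= (Bx b Bb) (By b Bb).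
by move=> x y /asboolP Bx /asboolP By; apply/asboolP; apply: fixed_div.
Qed.

Record fixed_ring := FixedRing {
  fixed_val : K;
  _ : fixed_val \in fixed_pred
}.
HB.instance Definition _ := [isSub for fixed_val].
HB.instance Definition _ := [Choice of fixed_ring by <:].
HB.instance Definition _ := GRing.SubChoice_isSubUnitRing.Build K fixed_pred
  fixed_ring fixed_divring_closed.

Fact fixed_unitr_neq0 (x : fixed_ring) : x != 0 -> x \is a GRing.unit.
Proof.
move=> x0; have vx0 : val x != 0 by [].
have Vx : (val x)^-1 \in fixed_pred.
  have /asboolP xB := valP x; apply/asboolP => b Bb.
  by rewrite rmorphV ?unitr_neq0 //= xB.
apply/unitrP; exists (FixedRing Vx); split; apply: val_inj.
  by rewrite rmorphM /= divring_mulVf.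
by rewrite rmorphM /= divring_mulfV.
Qed.
HB.instance Definition _ :=
  UnitRing_isDivisionRing.Build fixed_ring fixed_unitr_neq0.
End FixedRing.

Lemma multiplicative1 (G G' : groupType) (f : {multiplicative G -> G'}) :
  f 1%g = 1%g.
Proof. by apply: (mulgI (f 1%g)); rewrite -gmulfM !mulg1. Qed.

Lemma multiplicativeV (G G' : groupType) (f : {multiplicative G -> G'}) x :
  f (x^-1)%g = ((f x)^-1)%g.
Proof. by apply: (mulgI (f x)); rewrite -gmulfM !mulgV multiplicative1. Qed.

Lemma multiplicative_of (G G' : groupType) (f : G -> G') :
  {morph f : x y / (x * y)%g} -> exists F : {multiplicative G -> G'}, F =1 f.
Proof.
move=> fM; pose m := isMultiplicative.Build G G' f fM.
by exists (HB.pack_for {multiplicative G -> G'} f m).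
Qed.

Lemma surj_inj_bij (A B : Type) (f : A -> B) :
  injective f -> (forall y, exists x, f x = y) -> bijective f.
Proof. by move=> fI /choice[g gK]; exists g => // x; apply: fI; rewrite gK. Qed.

(** [E] is the fixed ring of the kernel [N] of [p].  Elements of [Gal(F/H)] that
    agree on [E] agree modulo [N] because [N] is, by [artin_maximal], the group of
    all automorphisms that fix [E]; so [p] induces [beta] on [Gal(E/H)]. *)
Lemma galois_quotient (H F : divisionRingType) (iF : {rmorphism H -> F})
    (G : finGroupType) (p : {multiplicative gal iF -> G}) :
  artin_galois iF -> finite_set (aut_over iF) ->
  (forall c, centralizer (range iF) c -> c \in centre F) ->
  (forall g, exists s, p s = g) ->
  exists (E : divisionRingType) (e : {rmorphism E -> F})
    (i : {rmorphism H -> E}) (beta : {multiplicative gal i -> G}),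
    [/\ forall a, e (i a) = iF a, artin_galois i, bijective beta,
        forall t : gal i, exists2 s : gal iF, restricts e s t & beta t = p s &
        forall x, (forall s, p s = 1%g -> s x = x) -> exists y, x = e y].
Proof.
move=> artin finG outer psurj.
pose N : set (ring_aut F) :=
  [set s | exists2 s' : gal iF, gal_aut s' = s & p s' = 1%g]%classic.
have NP (s : gal iF) : N s -> p s = 1%g by move=> [s' /val_inj->].
have Ngrp : is_subgroup N.
  split=> [|_ _ [s <- ps] [t <- pt]|_ [s <- ps]].
  - by exists 1%g => //; rewrite multiplicative1.
  - by exists (s * t)%g => //; rewrite gmulfM ps pt mulg1.
  - by exists (s^-1)%g => //; rewrite multiplicativeV ps invg1.
pose E : divisionRingType := fixed_ring N.
pose e : {rmorphism E -> F} := val.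
have eP x : fixed N x -> exists y : E, x = e y.
  by move=> /asboolP xN; exists (FixedRing xN).
have Ne (y : E) : fixed N (e y) by apply/asboolP; apply: (valP (y : fixed_ring N)).
have [i iE] : exists i : {rmorphism H -> E}, forall a, e (i a) = iF a.
  apply: factor_through => a; apply: eP => _ [s <- _]; exact: galE.
have stableN (s : gal iF) (x : E) : exists y, s (e x) = e y.
  apply: eP => _ [n <- pn].
  have /(Ne x) : N (s^-1 * n * s)%g.
    by exists (s^-1 * n * s)%g => //; rewrite !gmulfM multiplicativeV pn mulg1 mulVg.
  by move=> /(congr1 s); rewrite -[in LHS]autM !mulgA mulgV mul1g.
have galE_restr (s : gal iF) : exists t : gal i, restricts e s t.
  have [t st] := restrict_aut (stableN s) (stableN (s^-1)%g).
  have [a|t' tE] := @gal_of_aut _ _ i t; last by exists t'; rewrite tE.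
  by apply: (@divring_morph_inj _ _ e); rewrite -st iE galE.
have outerE c : centralizer (range i) c -> c \in centre E.
  move=> ci; apply/centreP => x; apply: (@divring_morph_inj _ _ e).
  have /centreP cZ : e c \in centre F.
    by apply: outer => _ [a _ <-]; rewrite -iE -!rmorphM ci.
  by rewrite !rmorphM cZ.
have finN : finite_set N.
  by apply: sub_finite_set finG => _ [s <- _] a; apply: galE.
have p_restr (s s' : gal iF) : (forall x, s (e x) = s' (e x)) -> p s = p s'.
  move=> ss'; apply: (mulgI (p s')^-1)%g; rewrite mulVg -multiplicativeV -gmulfM.
  apply: NP; apply: artin_maximal => // [c cN|x /asboolP xN].
    by apply: outer => _ [a _ <-]; apply: cN => _ [t <- _]; exact: galE.
  have := ss' (FixedRing xN); rewrite /= => sx.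
  by rewrite [LHS](congr1 (s'^-1)%g sx) [LHS]aut_funK.
have restr_p (s s' : gal iF) x : p s = p s' -> s (e x) = s' (e x).
  move=> pss'; have /(Ne x) : N (s'^-1 * s)%g.
    by exists (s'^-1 * s)%g => //; rewrite gmulfM multiplicativeV pss' mulVg.
  by move=> /(congr1 s'); rewrite -[in LHS]autM mulgA mulgV mul1g.
have restr_surj := restriction_surjective iE artin galE_restr finG outerE.
have [r rP] := choice restr_surj.
have [|beta betaE] := @multiplicative_of (gal i) G (p \o r).
  move=> t t'; rewrite /= -gmulfM; apply: p_restr => x.
  by rewrite rP (restrictsM (rP t) (rP t')).
exists E, e, i, beta; split=> //.
- exact: artin_galois_restriction iE artin galE_restr.
- apply: surj_inj_bij => [t t'|g].
    rewrite !betaE /= => ptt'; apply: gal_eqP => x.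
    by apply: (@divring_morph_inj _ _ e); rewrite -!rP; apply: restr_p.
  have [s sg] := psurj g; have [t st] := galE_restr s; exists t.
  by rewrite betaE /= -sg; apply: p_restr => x; rewrite rP st.
- by move=> t; exists (r t); rewrite ?betaE.
- by move=> x xN; apply: eP => _ [s <- ps]; apply: xN.
Qed.

(** * The fibre product of two group morphisms *)

(** The elements of [C] are encoded by their images under [gamma], so that the
    fibre product is a subgroup of the finite group [G * G]. *)
Lemma fibre_product (G : finGroupType) (Q C : groupType)
    (alpha : {multiplicative G -> Q}) (gamma : {multiplicative C -> G}) :
  injective gamma ->
  exists (G' : finGroupType) (alpha' : {multiplicative G' -> C})
    (pi : {multiplicative G' -> G}),
    [/\ forall x, alpha (pi x) = alpha (gamma (alpha' x)),
        forall g s, alpha g = alpha (gamma s) ->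
          exists2 x, pi x = g & alpha' x = s,
        exists sec : {multiplicative C -> G'}, forall s, alpha' (sec s) = s &
        [set g | alpha g == 1%g]%SET \isog [set x | alpha' x == 1%g]%SET].
Proof.
move=> gammaI.
pose D : {set G * G} :=
  [set x | (alpha x.1 == alpha x.2) && `[< exists s, gamma s = x.2 >]]%SET.
have DP x : reflect (alpha x.1 = alpha x.2 /\ exists s, gamma s = x.2) (x \in D).
  rewrite inE; apply: (iffP andP) => [[/eqP-> /asboolP]|[-> /asboolP]] //.
have Dgrp : group_set D.
  apply/group_setP; split=> [|x y /DP[x12 [s sx]] /DP[y12 [t ty]]].
    by apply/DP; split=> //; exists 1%g; rewrite multiplicative1.
  by apply/DP; split; [rewrite /= !gmulfM x12 y12 | exists (s * t)%g; rewrite gmulfM sx ty].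
pose G' : finGroupType := subg_of (Group Dgrp).
have inD g s : alpha g = alpha (gamma s) -> (g, gamma s) \in Group Dgrp.
  by move=> gs; apply/DP; split=> //; exists s.
have valD (x : G') : alpha (sgval x).1 = alpha (sgval x).2 /\
    exists s, gamma s = (sgval x).2 by apply/DP/subgP.
have [a aP] := choice (fun x => (valD x).2).
have [|alpha' alphaE] := @multiplicative_of G' C a.
  by move=> x y; apply: gammaI; rewrite gmulfM !aP.
have [|pi piE] := @multiplicative_of G' G (fun x => (sgval x).1); first by [].
have [|sec secE] := @multiplicative_of C G' (fun s => Subg (inD (gamma s) s erefl)).
  by move=> s t; apply: val_inj; rewrite /= !gmulfM.
have sgE (x : G') : sgval x = (pi x, gamma (alpha' x)).
  by rewrite piE alphaE aP; case: (sgval x).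
exists G', alpha', pi; split.
- by move=> x; rewrite piE alphaE aP; case: (valD x).
- move=> g s gs; exists (Subg (inD g s gs)); first by rewrite piE.
  by apply: gammaI; rewrite alphaE aP.
- by exists sec => s; apply: gammaI; rewrite secE alphaE aP.
(* The isomorphism of the kernels is [g |-> (g, 1)]. *)
have in1 g : alpha g = 1%g -> (g, gamma 1%g) \in Group Dgrp.
  by move=> g1; apply: (inD); rewrite g1 !multiplicative1.
pose f (g : G) : G' := subg (Group Dgrp) (g, 1%g).
have fK g : alpha g = 1%g -> sgval (f g) = (g, 1%g).
  by move=> g1; rewrite /f subgK //; have := in1 g g1; rewrite multiplicative1.
have fE g : alpha g = 1%g -> alpha' (f g) = 1%g /\ pi (f g) = g.
  move=> g1; have := sgE (f g); rewrite fK // => -[gE gf1]; split=> //.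
  by apply: gammaI; rewrite -gf1 multiplicative1.
have Ef x : alpha' x = 1%g -> alpha (pi x) = 1%g /\ f (pi x) = x.
  move=> x1; have pix1 : alpha (pi x) = 1%g.
    by rewrite piE (valD x).1 -[(sgval x).2]aP -alphaE x1 !multiplicative1.
  by split=> //; apply: val_inj; rewrite /= fK // sgE x1 multiplicative1.
apply: (@misom_isog G G' _ _ f); apply/andP; split.
  apply/morphicP => g h; rewrite !inE => /eqP g1 /eqP h1; apply: val_inj.
  by rewrite /= !fK // ?gmulfM ?g1 ?h1 ?mulg1 //; congr (_, _); rewrite mulg1.
apply/eqP/setP => x; apply/imsetP/idP => [[g]|].
  rewrite !inE => /andP[gN1 /eqP g1] ->; have [-> fgg] := fE g g1.
  rewrite eqxx andbT; apply: contra_neq gN1 => fg1.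
  by rewrite -fgg fg1 multiplicative1.
rewrite !inE => /andP[xN1 /eqP x1]; have [px1 fpx] := Ef x x1.
exists (pi x) => //; rewrite !inE px1 eqxx andbT; apply: contra_neq xN1 => px.
have [_ {1}<-] := Ef _ x1; rewrite px; apply: val_inj.
by rewrite /= fK ?multiplicative1.
Qed.

(** * The tower of skew fraction rings *)

Section FractionTower.
Variables (H L L' : divisionRingType).
Variables (i : {rmorphism H -> L}) (i' : {rmorphism H -> L'}).
Variable j : {rmorphism L -> L'}.
Hypothesis jiE : forall a, j (i a) = i' a.
Variables (sigma : ring_aut H) (tau : ring_aut L) (tau' : ring_aut L').
Variables (Ht Lt L't : divisionRingType).
Variable fH : {rmorphism skew_poly sigma -> Ht}.
Variable fL : {rmorphism skew_poly tau -> Lt}.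
Variable fL' : {rmorphism skew_poly tau' -> L't}.
Variables (it : {rmorphism Ht -> Lt}) (jt : {rmorphism Lt -> L't}).
Variable it' : {rmorphism Ht -> L't}.
Hypothesis fHfrac : division_ring_of_fractions fH.
Hypothesis fLfrac : division_ring_of_fractions fL.
Hypothesis itE : forall p, it (fH p) = fL (skew_map i tau p).
Hypothesis jtE : forall p, jt (fL p) = fL' (skew_map j tau' p).
Hypothesis it'E : forall p, it' (fH p) = fL' (skew_map i' tau' p).

Lemma tower_X : it (fH (skewX sigma)) = fL (skewX tau).
Proof. by rewrite itE /skew_map map_polyX. Qed.

Lemma tower_C a : it (fH (skewC sigma a)) = fL (skewC tau (i a)).
Proof. by rewrite itE /skew_map map_polyC. Qed.

Lemma tower_comp x : jt (it x) = it' x.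
Proof.
move: x; apply: (fraction_ind fHfrac) => [a||x y Hx Hy|x y Hx Hy|x x0 Hx].
- by rewrite tower_C jtE it'E /skew_map !map_polyC /= jiE.
- by rewrite tower_X jtE it'E /skew_map !map_polyX.
- by rewrite !rmorphB Hx Hy.
- by rewrite !rmorphM Hx Hy.
- by rewrite !rmorphV ?Hx // unitr_neq0 // raddf_eq0 //; apply: divring_morph_inj.
Qed.

(** Automorphisms over [H(t)] fix [t], so their action on constants determines
    them. *)
Lemma gal_constants_inj (s t : gal it) (u : ring_aut L) :
  restricts (fL \o skewC tau) s u -> restricts (fL \o skewC tau) t u -> s = t.
Proof.
move=> su tu; apply: gal_eqP.
apply: (fraction_ind fLfrac) => [a||x y Hx Hy|x y Hx Hy|x x0 Hx].
- by rewrite [LHS]su [RHS]tu.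
- by rewrite -tower_X !galE.
- by rewrite !rmorphB /= Hx Hy.
- by rewrite !rmorphM /= Hx Hy.
- by rewrite !rmorphV ?unitr_neq0 //= Hx.
Qed.

(** [s] fixes [t], which lies in [H(t)], and acts on the constants of [L(t)]
    through [u]; so it maps [L(t)] onto itself. *)
Lemma fraction_restriction (s : gal it') (u' : ring_aut L') (u : ring_aut L) :
  restricts (fL' \o skewC tau') s u' -> restricts j u' u ->
  exists2 t : gal it, restricts jt s t & restricts (fL \o skewC tau) t u.
Proof.
move=> su' u'u.
have jtC a : jt (fL (skewC tau a)) = fL' (skewC tau' (j a)).
  by rewrite jtE /skew_map map_polyC.
have stable (r : gal it') (v' : ring_aut L') (v : ring_aut L) :
    restricts (fL' \o skewC tau') r v' -> restricts j v' v ->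
    forall x, exists y, r (jt x) = jt y.
  move=> rv' v'v; apply: (fraction_ind fLfrac).
  - by move=> a; exists (fL (skewC tau (v a))); rewrite !jtC -v'v -[RHS]rv'.
  - exists (fL (skewX tau)); rewrite -tower_X tower_comp; exact: galE.
  - move=> x y [x' Hx] [y' Hy]; exists (x' - y').
    by rewrite !rmorphB /= Hx Hy.
  - move=> x y [x' Hx] [y' Hy]; exists (x' * y').
    by rewrite !rmorphM /= Hx Hy.
  - move=> x x0 [x' Hx]; exists x'^-1.
    have jt0 : jt x != 0 by rewrite raddf_eq0 //; apply: divring_morph_inj.
    have x'0 : x' != 0.
      apply: contra_neq jt0 => x'0; apply: (bij_inj (aut_bij r)).
      by rewrite Hx x'0 !rmorph0.
    by rewrite !rmorphV ?unitr_neq0 //= Hx.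
have [t st] := restrict_aut (stable _ _ _ su' u'u)
  (stable (s^-1)%g _ _ (restrictsV su') (restrictsV u'u)).
have [a|t' tE] := @gal_of_aut _ _ it t.
  by apply: (@divring_morph_inj _ _ jt); rewrite -st tower_comp galE.
exists t'; rewrite tE // => a; apply: (@divring_morph_inj _ _ jt).
by rewrite -st /= !jtC -u'u -[RHS]su'.
Qed.
End FractionTower.

(** * Reduction to a split embedding problem *)

Theorem proposition5p3
  (* the finite embedding problem alpha : G -> Gal(L/H) and sigma, tau *)
  (H : divisionRingType) (finH : finite_dim_over_centre H)
  (sigma : ring_aut H)
  (L : divisionRingType) (i : {rmorphism H -> L})
  (G : finGroupType) (alpha : {multiplicative G -> gal i})
  (alphaP : finite_embedding_problem alpha)
  (tau : ring_aut L) (tauE : forall a, tau (i a) = i (sigma a))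
  (tau_dprod : centre_dprod i tau)
  (* the weak solution gamma : Gal(L'/H) -> G and tau' *)
  (L' : divisionRingType) (i' : {rmorphism H -> L'}) (j : {rmorphism L -> L'})
  (gamma : {multiplicative gal i' -> G})
  (gammaP : weak_solution alpha j gamma)
  (tau' : ring_aut L')
  (tau'_finite : exists2 n : nat, (0 < n)%N & (tau' ^+ n)%g = 1%g)
  (tau'E : forall x, tau' (j x) = j (tau x))
  (tau'_dprod : centre_dprod i' tau') :
  exists (G' : finGroupType) (alpha' : {multiplicative G' -> gal i'}),
    [/\ finite_embedding_problem alpha',
        split_problem alpha',
        hom_ker alpha \isog hom_ker alpha'
      & (* the tower H(t,sigma) <= L(t,tau) <= L'(t,tau') *)
        forall (Ht Lt L't : divisionRingType)
          (fH : {rmorphism skew_poly sigma -> Ht})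
          (fL : {rmorphism skew_poly tau -> Lt})
          (fL' : {rmorphism skew_poly tau' -> L't})
          (it : {rmorphism Ht -> Lt}) (jt : {rmorphism Lt -> L't})
          (it' : {rmorphism Ht -> L't}),
        division_ring_of_fractions fH ->
        division_ring_of_fractions fL ->
        division_ring_of_fractions fL' ->
        (forall p, it (fH p) = fL (skew_map i tau p)) ->
        (forall p, jt (fL p) = fL' (skew_map j tau' p)) ->
        (forall p, it' (fH p) = fL' (skew_map i' tau' p)) ->
        forall (E' : divisionRingType) (iE' : {rmorphism Ht -> E'})
          (jE' : {rmorphism L't -> E'})
          (beta' : {multiplicative gal iE' -> G'}),
        geometric_solution alpha' it' fL' jE' beta' ->
        exists (E : divisionRingType) (iE : {rmorphism Ht -> E})
          (jE : {rmorphism Lt -> E}) (beta : {multiplicative gal iE -> G})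
          (e : {rmorphism E -> E'}),
          [/\ geometric_solution alpha it fL jE beta,
              forall x, e (iE x) = iE' x
            & forall x, e (jE x) = jE' (jt x)]].
Proof.
have [artin_i alpha_surj] := alphaP.
have [jiE artin_i' gammaI gamma_res] := gammaP.
have [G' [alpha' [pi [alpha_pi pi_surj [sec secK] isog_ker]]]] :=
  fibre_product alpha gammaI.
have alpha'_surj (s : gal i') : exists x, alpha' x = s by exists (sec s).
have finG := finite_aut_over alpha_surj.
have finG' := finite_aut_over alpha'_surj.
have outer_i := outer_of_finite_dim finH artin_i finG.
exists G', alpha'; split=> //.
  exists sec => //; apply: can_inj secK.
move=> Ht Lt L't fH fL fL' it jt it' fHfrac fLfrac fL'frac itE jtE it'E.
move=> E' iE' jE' beta' [alphat' [alphat'_res [artin_it' alphat'_surj]]].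
move=> [[jit'E artin_E' beta'I beta'_res] beta'_bij].
have [beta'i beta'K beta'iK] := beta'_bij.
have jitE := tower_comp jiE fHfrac itE jtE it'E.
have pi_onto g : exists x, pi x = g.
  have [|s sg] := restriction_surjective jiE artin_i' _ finG' outer_i (alpha g).
    by move=> s; exists (alpha (gamma s)).
  have [|x <- _] := pi_surj g s; last by exists x.
  by apply: val_inj; apply: restricts_inj sg (gamma_res s).
(* The extension to [Lt] of an element of [Gal(L/H)] is obtained by restricting
   a given automorphism of [L't/Ht], rather than coefficientwise. *)
have alphat'_restr x : exists2 t : gal it, restricts jt (alphat' x) t &
    restricts (fL \o skewC tau) t (alpha (pi x)).
  apply: (fraction_restriction jiE fHfrac fLfrac itE jtE it'E (alphat'_res x)).
  by rewrite alpha_pi; apply: gamma_res.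
have constI := gal_constants_inj fLfrac itE.
have /choice[a aP] g : exists t : gal it,
    restricts (fL \o skewC tau) t (alpha g).
  by have [x <-] := pi_onto g; have [t] := alphat'_restr x; exists t.
have [|alphat alphatE] := @multiplicative_of G (gal it) a.
  move=> g h; apply: constI (aP _) _; rewrite gmulfM.
  exact: restrictsM (aP g) (aP h).
have alphat_res g : restricts (fL \o skewC tau) (alphat g) (alpha g).
  by rewrite alphatE; apply: aP.
have alphat_jt x : restricts jt (alphat' x) (alphat (pi x)).
  have [t xt tpi] := alphat'_restr x.
  by rewrite (constI _ _ _ (alphat_res (pi x)) tpi).
have stable_it (s : gal it') : exists t : gal it, restricts jt s t.
  by have [x <-] := alphat'_surj s; exists (alphat (pi x)).
have finGt' := finite_aut_over alphat'_surj.
have outer_it c : centralizer (range it) c -> c \in centre Lt.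
  move=> cit; apply: (fraction_centreP fLfrac); last first.
    by rewrite -(tower_X itE); apply: cit; exists (fH (skewX sigma)).
  apply: (skew_fraction_centralizer finH artin_i finG tau_dprod fLfrac) => b.
  by rewrite -(tower_C itE); apply: cit; exists (fH (skewC sigma b)).
have alphat_surj (t : gal it) : exists g, alphat g = t.
  have [s st] := restriction_surjective jitE artin_it' stable_it finGt' outer_it t.
  have [x xs] := alphat'_surj s; exists (pi x); apply: val_inj.
  by apply: restricts_inj (alphat_jt x) _; rewrite xs.
have artin_it := artin_galois_restriction jitE artin_it' stable_it.
have finGE' : finite_set (aut_over iE').
  by apply: (@finite_aut_over _ _ iE' _ beta'i) => s; exists (beta' s).
have outer_E' : forall c, centralizer (range iE') c -> c \in centre E'.
  have [n n0 tau'n] := tau'_finite.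
  apply: (skew_fraction_outer n0 _ fHfrac finGE'); apply: autP => b.
  have i'X k : (tau' ^+ k)%g (i' b) = i' ((sigma ^+ k)%g b).
    elim: k b => [//|k IHk] b; rewrite !expgSr !autM -IHk.
    by rewrite -!jiE tau'E tauE.
  by apply: (@divring_morph_inj _ _ i'); rewrite -i'X tau'n.
have [p pE] : exists p : {multiplicative gal iE' -> G}, p =1 pi \o beta'.
  by apply: multiplicative_of => s t; rewrite /= !gmulfM.
have p_onto g : exists s, p s = g.
  have [x <-] := pi_onto g; exists (beta'i x).
  by rewrite pE /= beta'iK.
have [E [e [iE [beta [eiE artin_E beta_bij beta_p eP]]]]] :=
  galois_quotient artin_E' finGE' outer_E' p_onto.
(* By this relation the kernel of [p] fixes [Lt], so that [Lt] embeds in [E]. *)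
have beta'_jt (s : gal iE') : restricts (jE' \o jt) s (alphat (p s)).
  by move=> x; rewrite /= beta'_res alphat_jt pE.
have [x|jE jEe] := @factor_through Lt E E' e (jE' \o jt).
  apply: eP => s ps1.
  by have := beta'_jt s x; rewrite ps1 multiplicative1.
have eI := @divring_morph_inj _ _ e.
exists E, iE, jE, beta, e; split=> //.
exists alphat; split=> //; split=> //; split=> //.
- by move=> x; apply: eI; rewrite jEe /= jitE jit'E eiE.
- exact: bij_inj.
- move=> t x; apply: eI; have [s st ->] := beta_p t.
  by rewrite -st jEe [LHS]beta'_jt jEe.
Qed.
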